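(* For every $A<\infty$ there exists a constant $C_A<\infty$, depending only on $A$, such that the following holds. Let $G=(V,E)$ be a connected, locally finite, possibly infinite, simple graph whose random walk kernel $P$ satisfies $\mathrm{LH}(A)$. Then for every $x\in V$ and all real $r,t\ge e^e$, \[ \mathbb E_x\,\mathrm{dist}(x,X_t)^2\le t\exp\left[C_A\sqrt{\log (t)\,\log\log (t)}\right], \] \[ \mathcal H_t(x)\le \exp\left[C_A\sqrt{\log (t)\,\log\log (t)}\right], \] \[ \log\mathrm{Vol}(B(x,r))\le \exp\left[C_A\sqrt{\log (r)\,\log\log (r)}\right]. \]
   Context: $G=(V,E)$ has at least one edge. Its random walk kernel is $P(x,y)=\mathbf 1_{\{x\sim y\}}/\deg(x)$, and $m(x)=\deg(x)$. $\mathrm{dist}$ is the graph distance, $B(x,r)=\{y\in V:\mathrm{dist}(x,y)\le r\}$, and $\mathrm{Vol}(A)=\sum_{z\in A}m(z)$ for $A\subseteq V$. $(X_t)_{t\ge0}$ is the continuous-time random walk on $V$ with generator $L=P-I$, so that $\mathbb P_x(X_t=y)=P_t(x,y)=e^{-t}\sum_{k\ge0}\frac{t^k}{k!}P^k(x,y)$ ($(P_t)$ is the heat semigroup); $\mathbb E_x$ is expectation for the walk started at $X_0=x$. The heat entropy is $\mathcal H_t(x)=-\sum_{z\in V}P_t(x,z)\log\frac{P_t(x,z)}{m(z)}$ (with $0\log 0=0$). $D(\mu\|\nu)=\int\log(d\mu/d\nu)\,d\mu$ if $\mu\ll\nu$ and $+\infty$ otherwise is relative entropy. $P$ satisfies $\mathrm{LH}(A)$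 if, for all $x,y\in V$ and $t>0$, \[ D(P_t(x,\cdot)\|P_t(y,\cdot))\le A\left(\frac{\mathrm{dist}(x,y)^2}{t}+\frac{\mathrm{dist}(x,y)}{\sqrt t}\right). \] *)

(* Defs.v *)
From HB Require Import structures.
From mathcomp Require Import all_boot all_order all_algebra.
From mathcomp Require Import finmap.
From mathcomp Require Import all_classical all_reals all_analysis.
Set Implicit Arguments.
Unset Strict Implicit.
Unset Printing Implicit Defensive.
Import Order.TTheory GRing.Theory Num.Theory.
Import numFieldNormedType.Exports.

Local Open Scope classical_set_scope.
Local Open Scope ring_scope.

Record simple_graph (V : choiceType) := SimpleGraph {
  adj :> rel V;
  adj_sym : symmetric adj;
  adj_irr : irreflexive adj
}.

Section Graph.
Context (V : choiceType) (G : simple_graph V).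

Definition neighbours (x : V) : set V := [set y | adj G x y].

Definition locally_finite := forall x, finite_set (neighbours x).

Definition has_edge := exists x y, adj G x y.

(* Boolean through classical logic, so that [ex_minn] applies. *)
Definition walk_of_length (x y : V) : pred nat := fun n =>
  `[< exists s : seq V, [/\ path (adj G) x s, last x s = y & size s = n] >].

Definition connected_graph := forall x y, exists n, walk_of_length x y n.

(* The value 0 for vertices in different components is never used: graphs are
   connected in the sequel. *)
Definition dist (x y : V) : nat :=
  if pselect (exists n, walk_of_length x y n) is left h then ex_minn h else 0%N.

(* Meaningful when G is locally finite. *)
Definition deg (x : V) : nat := #|` fset_set (neighbours x)|.

End Graph.

(* Sum of a signed family over a (possibly uncountable) type: the sum of the
   positive parts minus that of the negative parts, which is the integral of f
   for the counting measure. [esum] alone is only meaningful for f >= 0. *)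
Definition signed_sum (R : realType) (V : choiceType) (f : V -> \bar R) : \bar R :=
  (\esum_(z in [set: V]) (f^\+)%E z - \esum_(z in [set: V]) (f^\-)%E z)%E.

(* D(p || q) for measures on the discrete space V given by their masses
   p, q : V -> R, with respect to which dp/dq = p / q wherever q > 0. The
   points where p vanishes contribute 0. *)
Definition relative_entropy (R : realType) (V : choiceType) (p q : V -> R) : \bar R :=
  if `[< forall z, q z = 0 -> p z = 0 >]
  then signed_sum (fun z => (p z * ln (p z / q z))%:E)
  else +oo%E.

Section RandomWalk.
Context (R : realType) (V : choiceType) (G : simple_graph V).

Definition walk_kernel (x y : V) : R :=
  if adj G x y then (deg G x)%:R^-1 else 0.

(* The sum over all of V has finitely many nonzero terms when G is locally
   finite. *)
Fixpoint walk_kernel_pow (k : nat) (x y : V) : R :=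
  if k is k'.+1 then
    \sum_(z \in [set: V]) walk_kernel x z * walk_kernel_pow k' z y
  else (x == y)%:R.

Definition heat_kernel (t : R) (x y : V) : R :=
  expR (- t) *
  limn (series (fun k => t ^+ k / k`!%:R * walk_kernel_pow k x y)).

(* E_x[f(X_t)] for f >= 0, where P_x(X_t = y) = heat_kernel t x y. *)
Definition walk_expectation (t : R) (x : V) (f : V -> R) : \bar R :=
  \esum_(y in [set: V]) (heat_kernel t x y * f y)%:E.

(* [ln 0 = 0] in the library, but only 0 * log 0 = 0 matters here. *)
Definition heat_entropy (t : R) (x : V) : \bar R :=
  (- signed_sum (fun z =>
      (heat_kernel t x z * ln (heat_kernel t x z / (deg G z)%:R))%:E))%E.

Definition LH (A : R) := forall (x y : V) (t : R), 0 < t ->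
  (relative_entropy (heat_kernel t x) (heat_kernel t y) <=
   (A * ((dist G x y)%:R ^+ 2 / t + (dist G x y)%:R / Num.sqrt t))%:E)%E.

Definition graph_ball (x : V) (r : R) : set V := [set y | (dist G x y)%:R <= r].

Definition Vol (A : set V) : \bar R := \esum_(z in A) ((deg G z)%:R)%:E.

End RandomWalk.

(* Main.v *)
Require Import Defs.
From mathcomp Require Import all_boot all_order all_algebra.
From mathcomp Require Import finmap.
From mathcomp Require Import all_classical all_reals all_analysis.
From mathcomp Require Import ring lra.
Set Implicit Arguments.
Unset Strict Implicit.
Unset Printing Implicit Defensive.
Import Order.TTheory GRing.Theory Num.Theory.
Import numFieldNormedType.Exports.
Local Open Scope classical_set_scope.
Local Open Scope ring_scope.

(** Write m for the degree, P_t for the heat kernel and p_t(x,z) = P_t(x,z)/m(z)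
    for its density, which is symmetric and at most 1. The surprisal
    - ln p_t(x,z) is thus nonnegative, and the heat entropy H_t(x) is its
    average under P_t(x,.). Everything is reduced to a bound for
    h(t) = sup_x H_t(x).

    Entropy controls displacement. Carne's Chebyshev argument ([carne],
    [heat_kernel_decay]) gives
    p_t(x,z) <= 2 exp (- l d + (cosh l - 1) t) with d = dist(x,z), for every
    l >= 0. Optimising in l at each z shows that d^2 is at most of order
    t (- ln p_t(x,z) + 1) as long as d = O(t), and larger distances have an
    exponentially small probability. Hence E_x dist(x,X_t)^2 = O(t (h(t) + 1))
    ([second_moment_le]).

    Displacement controls the growth of entropy. Conditioning on X_s and using
    the convexity of - ln, H_(s+t)(x) is at most the average of
    H_t(y) + D(P_t(y,.) || P_t(y',.)) over two independent copies y, y' of X_s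
    ([entropyD_le]). The log-Harnack hypothesis bounds the divergence by
    O(dist(y,y')^2/t + 1), so that, with the previous paragraph,
    h(t + s) <= h(t) + C ((s/t) (h(s) + 1) + 1) ([entropy_increment]).
    Going from u to 2 u in K steps of length u/K yields
    h(2 u) <= h(u) + C (h(u/K) + 1) + C K ([entropy_double]).

    Along the times tau 2^n, with K = 2^k, this is a recursion with delay k:
    over k consecutive steps the bound is multiplied by O(k), so that at
    t = tau 2^N it is at most exp (O(k)) O(k)^(N/k) ([dyadic_blocks]). The choice
    of k of order sqrt (ln t ln ln t) makes both factors
    exp (O(sqrt (ln t ln ln t))) ([block_bound_le]). The recursion starts from a
    bound for 1 <= t <= 2 that depends on the degrees only
    ([entropy_short_time]), and the log-Harnack inequality at time 1 bounds the
    degrees ([ln_deg_le]).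

    Entropy controls volume. By convexity once more and the log-Harnack
    inequality at t = r^2, - ln p_2t(x,y) <= H_t(x) + 2 A for all y in B(x,r);
    since P_2t(x,.) has total mass 1, ln Vol B(x,r) <= H_(r^2)(x) + 2 A
    ([Vol_le]). *)

(** * Averages with respect to weights on a discrete space *)

Section Averages.
Context {R : realType}.

Lemma esumZl (T : choiceType) (c : R) (g : T -> \bar R) :
  0 <= c -> (forall z, (0 <= g z)%E) ->
  (\esum_(z in [set: T]) (c%:E * g z) = c%:E * \esum_(z in [set: T]) g z)%E.
Proof.
have key (d : R) (h : T -> \bar R) : 0 <= d -> (forall z, (0 <= h z)%E) ->
    (\esum_(z in [set: T]) (d%:E * h z) <= d%:E * \esum_(z in [set: T]) h z)%E.
  move=> d0 h0; apply: ge_ereal_sup => _ [X [finX _]] <-.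
  rewrite fsbig_finite//= -ge0_sume_distrr; last by move=> *; exact: h0.
  rewrite lee_wpmul2l ?lee_fin// -fsbig_finite//.
  by apply: esum_ge; exists X.
rewrite le_eqVlt => /predU1P[<-|c0] g0.
  by rewrite mul0e esum1// => z _; rewrite mul0e.
have c0W := ltW c0; apply/eqP; rewrite eq_le key//= -lee_pdivlMl//.
have cV : (0 <= c^-1)%R by rewrite invr_ge0 ltW.
have cg0 z : (0 <= c%:E * g z)%E by rewrite mule_ge0// lee_fin ltW.
apply: le_trans (key _ _ cV cg0); apply: le_esum => z _.
by rewrite muleA -EFinM mulVf ?mul1e// gt_eqF.
Qed.

Lemma esum_exchange (S T : choiceType) (g : S -> T -> \bar R) :
  (forall y z, (0 <= g y z)%E) ->
  (\esum_(y in [set: S]) \esum_(z in [set: T]) g y z =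
   \esum_(z in [set: T]) \esum_(y in [set: S]) g y z)%E.
Proof.
move=> g0; rewrite (esum_esum (J := fun=> setT))//.
rewrite (esum_esum (J := fun=> setT) (a := fun z y => g y z))//.
rewrite (@reindex_esum R _ _ (setT `*`` (fun=> setT)) _
  (fun u : T * S => (u.2, u.1)))//.
split.
- by move=> [a b].
- by move=> [a b] [c d] _ _ /= [-> ->].
- by move=> [a b] _; exists (b, a).
Qed.

(** The function g takes extended values, so that entropies can be averaged
    before they are known to be finite. *)
Definition average (T : choiceType) (p : T -> R) (g : T -> \bar R) : \bar R :=
  (\esum_(z in [set: T]) ((p z)%:E * g z))%E.

Section Theory.
Context {T : choiceType}.
Implicit Types (p : T -> R) (g h : T -> \bar R).

Lemma average_ge0 p g :
  (forall z, 0 <= p z) -> (forall z, (0 <= g z)%E) -> (0 <= average p g)%E.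
Proof. by move=> p0 g0; apply: esum_ge0 => z _; rewrite mule_ge0// lee_fin. Qed.

Lemma le_average p g h : (forall z, 0 <= p z) ->
  (forall z, 0 < p z -> (g z <= h z)%E) -> (average p g <= average p h)%E.
Proof.
move=> p0 gh; apply: le_esum => z _.
have := p0 z; rewrite le_eqVlt => /predU1P[<-|pz]; first by rewrite !mul0e.
by rewrite lee_pmul2l//; exact: gh.
Qed.

Lemma averageD p g h : (forall z, 0 <= p z) ->
  (forall z, (0 <= g z)%E) -> (forall z, (0 <= h z)%E) ->
  (average p (fun z => g z + h z) = average p g + average p h)%E.
Proof.
move=> p0 g0 h0; rewrite /average -esumD; last 2 first.
- by move=> z _; rewrite mule_ge0// lee_fin.
- by move=> z _; rewrite mule_ge0// lee_fin.
by apply: eq_esum => z _; rewrite ge0_muleDr.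
Qed.

Lemma averageZl p g (c : R) : 0 <= c -> (forall z, 0 <= p z) ->
  (forall z, (0 <= g z)%E) ->
  (average p (fun z => c%:E * g z) = c%:E * average p g)%E.
Proof.
move=> c0 p0 g0; rewrite /average -esumZl//.
  by apply: eq_esum => z _; rewrite muleCA.
by move=> z; rewrite mule_ge0// lee_fin.
Qed.

Lemma average_cst p (c : R) : 0 <= c -> (forall z, 0 <= p z) ->
  average p (fun=> 1%E) = 1%E -> average p (fun=> c%:E) = c%:E.
Proof.
move=> c0 p0 p1; rewrite -[in LHS](mule1 c%:E).
by rewrite (averageZl (g := fun=> 1%E)) ?p1 ?mule1.
Qed.

Lemma average_ge_term p g z : (forall z, 0 <= p z) -> (forall z, (0 <= g z)%E) ->
  ((p z)%:E * g z <= average p g)%E.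
Proof.
move=> p0 g0; have pg0 w : (0 <= (p w)%:E * g w)%E by rewrite mule_ge0// lee_fin.
rewrite /average (esumID [set z])// setTI.
by rewrite esum_set1// leeDl// esum_ge0.
Qed.

End Theory.

(** Tonelli's theorem, whence no integrability condition on g. *)
Lemma average_mixture (S T : choiceType) (p : S -> R) (K : S -> T -> R)
    (q : T -> R) (g : T -> \bar R) :
  (forall y, 0 <= p y) -> (forall y z, 0 <= K y z) ->
  (forall z, (0 <= g z)%E) ->
  (forall z, (q z)%:E = average p (fun y => (K y z)%:E)) ->
  average q g = average p (fun y => average (K y) g).
Proof.
move=> p0 K0 g0 qE; rewrite /average.
transitivity (\esum_(z in [set: T]) \esum_(y in [set: S])
   ((p y)%:E * ((K y z)%:E * g z)))%E.
  apply: eq_esum => z _; rewrite qE /average.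
  move: (g0 z); case: (g z) => [r| |]// r0.
    rewrite muleC -esumZl => [||y]; last 2 first.
    - by [].
    - by rewrite mule_ge0 ?lee_fin.
    by apply: eq_esum => y _; rewrite muleC -muleA.
  have t0 y : (0 <= (p y)%:E * (K y z)%:E)%E by rewrite mule_ge0// lee_fin.
  have [all0|/existsNP[y /eqP ne0]] := pselect (forall y, p y * K y z = 0).
    rewrite !esum1 ?mul0e// => y _; last by rewrite -EFinM all0.
    by rewrite muleA -EFinM all0 mul0e.
  have pK : (0 < (p y * K y z)%:E)%E by rewrite lte_fin lt_def ne0 mulr_ge0.
  rewrite gt0_muley.
    apply/esym/eqP; rewrite -leye_eq (esumID [set y])//; last first.
      by move=> w _; rewrite muleA mule_ge0.
    rewrite setTI esum_set1; last by rewrite muleA mule_ge0.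
    rewrite muleA -EFinM gt0_muley// leeDl// esum_ge0// => w _.
    by rewrite muleA mule_ge0.
  apply: lt_le_trans pK _; rewrite (esumID [set y])//.
  by rewrite setTI esum_set1// EFinM leeDl// esum_ge0.
rewrite esum_exchange => [|z y]; last by rewrite !mule_ge0// lee_fin.
by apply: eq_esum => y _; rewrite esumZl// => z; rewrite mule_ge0// lee_fin.
Qed.

Lemma average_exchange (S T : choiceType) (p : S -> R) (q : T -> R)
    (g : S -> T -> R) :
  (forall y, 0 <= p y) -> (forall z, 0 <= q z) -> (forall y z, 0 <= g y z) ->
  average p (fun y => average q (fun z => (g y z)%:E)) =
  average q (fun z => average p (fun y => (g y z)%:E)).
Proof.
move=> p0 q0 g0.
transitivity (\esum_(y in [set: S]) \esum_(z in [set: T])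
    ((p y)%:E * ((q z)%:E * (g y z)%:E)))%E.
  by apply: eq_esum => y _; rewrite esumZl// => z; rewrite mule_ge0// lee_fin.
rewrite esum_exchange => [|y z]; last by rewrite !mule_ge0// lee_fin.
apply: eq_esum => z _; rewrite -esumZl// => [|y]; last first.
  by rewrite mule_ge0// lee_fin.
by apply: eq_esum => y _; rewrite muleCA.
Qed.

Lemma average_delta (T : choiceType) (x : T) (g : T -> \bar R) :
  (forall z, (0 <= g z)%E) -> average (fun y => (x == y)%:R) g = g x.
Proof.
move=> g0; rewrite /average (esumID [set x]); last first.
  by move=> z _; rewrite mule_ge0// lee_fin.
rewrite setTI esum_set1; last by rewrite mule_ge0// lee_fin.
rewrite eqxx mul1e esum1 ?adde0// => z [_ /= zx].
by rewrite (_ : (x == z) = false) ?mul0e//; apply/negbTE/eqP => /esym.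
Qed.

Lemma average_fset (T : choiceType) (p : T -> R) (F : {fset T}) (f : T -> R) :
  (forall z, 0 <= p z) -> (forall z, 0 <= f z) ->
  (forall z, z \notin F -> p z * f z = 0) ->
  average p (fun z => (f z)%:E) = (\sum_(z <- F) p z * f z)%:E.
Proof.
move=> p0 f0 pF; rewrite /average (esumID [set` F]); last first.
  by move=> z _; rewrite -EFinM lee_fin mulr_ge0.
rewrite setTI [X in (_ + X)%E]esum1 ?adde0; last first.
  by move=> z [_ /= /negP zF]; rewrite -EFinM pF.
rewrite esum_fset//; last by move=> z _; rewrite -EFinM lee_fin mulr_ge0.
by rewrite fsbig_finite//= set_fsetK sumEFin.
Qed.

End Averages.

(** * Powers of the random walk kernel *)

Section KernelPowers.
Context {R : realType} {V : choiceType} {G : simple_graph V}.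
Hypothesis lf : locally_finite G.
Hypothesis deg_gt0 : forall x, (0 < deg G x)%N.

Local Notation P := (walk_kernel R G).
Local Notation Pn := (@walk_kernel_pow R V G).
Local Notation m x := ((deg G x)%:R : R).

Lemma in_neighbours x z : (z \in fset_set (neighbours G x)) = adj G x z.
Proof. by rewrite in_fset_set//; apply/idP/idP; rewrite inE. Qed.

Lemma degR_gt0 x : 0 < m x. Proof. by rewrite ltr0n. Qed.

Lemma degR_ge1 x : 1 <= m x. Proof. by rewrite ler1n. Qed.

Lemma walk_kernel_ge0 x y : 0 <= P x y.
Proof. by rewrite /walk_kernel; case: ifP => // _; rewrite invr_ge0. Qed.
Hint Resolve walk_kernel_ge0 : core.

Lemma walk_kernel_pow_ge0 k x y : 0 <= Pn k x y.
Proof.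
by elim: k x => [|k IH] x //=; apply: fsumr_ge0 => z _; rewrite mulr_ge0.
Qed.
Hint Resolve walk_kernel_pow_ge0 : core.

Lemma average_walk_kernel x (f : V -> R) : (forall z, 0 <= f z) ->
  average (P x) (fun z => (f z)%:E) =
  (\sum_(z <- fset_set (neighbours G x)) P x z * f z)%:E.
Proof.
move=> f0; apply: average_fset => // z; rewrite in_neighbours /walk_kernel.
by move/negbTE ->; rewrite mul0r.
Qed.

Lemma walk_kernel_powSE k x y :
  Pn k.+1 x y = \sum_(z <- fset_set (neighbours G x)) P x z * Pn k z y.
Proof.
rewrite /= (fsbigTE (fset_set (neighbours G x)))// => z.
by rewrite in_neighbours /walk_kernel => /negbTE ->; rewrite mul0r.
Qed.

Lemma walk_kernel_powS k x y :
  (Pn k.+1 x y)%:E = average (P x) (fun z => (Pn k z y)%:E).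
Proof. by rewrite average_walk_kernel// walk_kernel_powSE. Qed.

Lemma walk_kernel_stochastic x : average (P x) (fun=> 1%E) = 1%E.
Proof.
rewrite (average_walk_kernel _ (fun _ => ler01))//; congr (_%:E).
rewrite big_seq (eq_bigr (fun=> (m x)^-1)) => [|z]; last first.
  by rewrite in_neighbours mulr1 /walk_kernel => ->.
rewrite -big_seq big_const_seq count_predT iter_addr_0 -[_ *+ _]mulr_natr mulVf//.
by rewrite gt_eqF ?degR_gt0.
Qed.

Lemma walk_kernel_pow_stochastic k x : average (Pn k x) (fun=> 1%E) = 1%E.
Proof.
elim: k x => [|k IH] x; first by rewrite average_delta.
rewrite (average_mixture (p := P x) (K := Pn k))//; last exact: walk_kernel_powS.
rewrite (_ : (fun y => _) = (fun=> 1%E)) ?walk_kernel_stochastic//.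
by apply/funext => y.
Qed.

Lemma walk_kernel_powD j k x z :
  (Pn (j + k) x z)%:E = average (Pn j x) (fun y => (Pn k y z)%:E).
Proof.
elim: j x => [|j IH] x; first by rewrite average_delta// => w; rewrite lee_fin.
rewrite addSn walk_kernel_powS.
rewrite [RHS](average_mixture (p := P x) (K := Pn j))//.
- by apply: congr1; apply/funext => y; rewrite IH.
- by move=> w; rewrite lee_fin.
- exact: walk_kernel_powS.
Qed.

Lemma walk_kernel_pow1 x y : Pn 1 x y = P x y.
Proof.
rewrite walk_kernel_powSE; apply: EFin_inj; rewrite -average_walk_kernel//=.
rewrite -[RHS](average_delta y (g := fun z => (P x z)%:E)); last first.
  by move=> w; rewrite lee_fin.
apply: eq_esum => w _; rewrite muleC; congr ((_ %:R)%:E * _)%E.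
by rewrite eq_sym.
Qed.

Lemma walk_kernel_pow_le1 k x y : Pn k x y <= 1.
Proof.
rewrite -lee_fin -(walk_kernel_pow_stochastic k x) -[leLHS]mule1.
exact: (average_ge_term (g := fun=> 1%E)).
Qed.

Lemma walk_kernel_reversible x y : m x * P x y = m y * P y x.
Proof.
rewrite /walk_kernel (adj_sym G y x); case: ifP; rewrite ?mulr0// => _.
by rewrite !mulfV// gt_eqF ?degR_gt0.
Qed.

Lemma walk_kernel_pow_reversible k x y : m x * Pn k x y = m y * Pn k y x.
Proof.
elim: k x y => [|k IH] x y.
  by rewrite /= (eq_sym y); case: eqP => [->//|]; rewrite !mulr0.
apply: EFin_inj; rewrite !EFinM walk_kernel_powS -addn1 walk_kernel_powD.
have m0 w : 0 <= m w by [].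
rewrite -!averageZl//; try by move=> w; rewrite lee_fin.
apply: eq_esum => w _; rewrite -!EFinM walk_kernel_pow1; congr (_%:E).
by rewrite mulrCA mulrA walk_kernel_reversible -mulrA mulrCA IH; ring.
Qed.

(** * Graph distance and powers of the kernel *)

(** This transfers properties of the kernel to the distance: the
    Chapman-Kolmogorov equation becomes the triangle inequality, and
    reversibility the symmetry. *)
Lemma walk_of_lengthP n x y : reflect (0 < Pn n x y) (walk_of_length G x y n).
Proof.
apply: (iffP idP) => [/asboolP[s [ps ls sz]]|].
  elim: s n x ps ls sz => [|z s IH] n x /=.
    by move=> _ -> <-; rewrite /= eqxx ltr01.
  move=> /andP[xz ps] ls <-.
  rewrite -lte_fin walk_kernel_powS.
  apply: lt_le_trans (average_ge_term z _ _) => //; last first.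
    by move=> w; rewrite lee_fin.
  rewrite -EFinM lte_fin mulr_gt0//; last exact: IH ps ls erefl.
  by rewrite /walk_kernel xz invr_gt0 degR_gt0.
elim: n x => [|n IH] x.
  rewrite /=; case: eqP => [-> _|_]; last by rewrite ltxx.
  by apply/asboolP; exists [::].
move=> pos; suff [z xz Pz] : exists2 z, adj G x z & 0 < Pn n z y.
  move/asboolP: (IH _ Pz) => [s [ps ls sz]]; apply/asboolP; exists (z :: s).
  by rewrite /= xz ps ls sz.
have [z _ /=] := fsumr_gt0 [::] pos.
rewrite /walk_kernel; case: ifP => [xz|_]; last by rewrite mul0r ltxx.
by rewrite pmulr_rgt0 ?invr_gt0 ?degR_gt0//; exists z.
Qed.

Lemma dist_le n x y : 0 < Pn n x y -> (dist G x y <= n)%N.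
Proof.
move=> /walk_of_lengthP w; rewrite /dist; case: pselect => // h.
by case: ex_minnP => k _; apply.
Qed.

Hypothesis conn : connected_graph G.

Lemma walk_kernel_pow_dist_gt0 x y : 0 < Pn (dist G x y) x y.
Proof.
apply/walk_of_lengthP; rewrite /dist; case: pselect => [h|/(_ (conn x y))//].
by case: ex_minnP.
Qed.

Lemma dist_sym x y : dist G x y = dist G y x.
Proof.
apply/eqP; rewrite eqn_leq; apply/andP; split; apply: dist_le.
  rewrite -(pmulr_rgt0 _ (degR_gt0 x)) walk_kernel_pow_reversible.
  by rewrite pmulr_rgt0 ?degR_gt0// walk_kernel_pow_dist_gt0.
rewrite -(pmulr_rgt0 _ (degR_gt0 y)) walk_kernel_pow_reversible.
by rewrite pmulr_rgt0 ?degR_gt0// walk_kernel_pow_dist_gt0.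
Qed.

Lemma dist_triangle x y z : (dist G x z <= dist G x y + dist G y z)%N.
Proof.
apply: dist_le; rewrite -lte_fin walk_kernel_powD.
apply: lt_le_trans (average_ge_term y _ _) => //; last first.
  by move=> w; rewrite lee_fin.
by rewrite -EFinM lte_fin mulr_gt0 ?walk_kernel_pow_dist_gt0.
Qed.

Lemma dist_adj x y : adj G x y -> (dist G x y <= 1)%N.
Proof.
move=> xy; apply: dist_le; rewrite walk_kernel_pow1 /walk_kernel xy.
by rewrite invr_gt0 degR_gt0.
Qed.

(** Each step of a given walk is taken with probability at least 1/D. *)
Lemma walk_kernel_pow_ge (D : R) n x y : (forall z, m z <= D) ->
  0 < Pn n x y -> D^-1 ^+ n <= Pn n x y.
Proof.
move=> mD; have D0 : 0 < D by apply: lt_le_trans (degR_gt0 x) (mD x).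
elim: n x => [|n IH] x; first by rewrite /=; case: eqP => //; rewrite ltxx.
move=> pos.
have [z _ /=] := fsumr_gt0 [::] pos.
rewrite /walk_kernel; case: ifP => [xz|_]; last by rewrite mul0r ltxx.
rewrite pmulr_rgt0 ?invr_gt0 ?degR_gt0// => /IH le.
rewrite -lee_fin walk_kernel_powS.
apply: le_trans (average_ge_term z _ _) => //; last first.
  by move=> w; rewrite lee_fin.
have DV : 0 <= D^-1 by rewrite invr_ge0 ltW.
rewrite -EFinM lee_fin exprS ler_pM ?exprn_ge0//.
by rewrite /walk_kernel xz lef_pV2 ?posrE ?degR_gt0.
Qed.

End KernelPowers.

(** * The heat kernel as a Poisson mixture *)

Section Poisson.
Context {R : realType}.

Definition poisson (t : R) (k : nat) : R := expR (- t) * (t ^+ k / k`!%:R).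

Lemma poisson_ge0 t k : 0 <= t -> 0 <= poisson t k.
Proof. by move=> t0; rewrite mulr_ge0 ?expR_ge0// divr_ge0// exprn_ge0. Qed.

Lemma esum_exp_coeff (u : R) : 0 <= u ->
  (\esum_(k in [set: nat]) (u ^+ k / k`!%:R)%:E)%E = (expR u)%:E.
Proof.
move=> u0; have c0 k : (0 <= (u ^+ k / k`!%:R)%:E)%E.
  by rewrite lee_fin divr_ge0// exprn_ge0.
rewrite -nneseries_esumT//.
under eq_fun do rewrite sumEFin.
rewrite -[X in lim X]/((EFin \o series (exp_coeff u)) @ \oo).
rewrite EFin_lim//; exact: is_cvg_series_exp_coeff.
Qed.

(** The generating function of the Poisson law: a = 1 gives its total mass,
    a = cosh l the off-diagonal decay of the heat kernel, and a = e^2 an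
    exponential moment of the displacement. *)
Lemma average_poisson_geometric (t a : R) : 0 <= t -> 0 <= a ->
  average (poisson t) (fun k => (a ^+ k)%:E) = (expR ((a - 1) * t))%:E.
Proof.
move=> t0 a0.
have -> : expR ((a - 1) * t) = expR (- t) * expR (a * t).
  by rewrite -expRD; congr expR; ring.
rewrite EFinM.
rewrite -(esum_exp_coeff (mulr_ge0 a0 t0)) -esumZl ?expR_ge0//; last first.
  by move=> k; rewrite lee_fin divr_ge0// exprn_ge0// mulr_ge0.
by apply: eq_esum => k _; rewrite -!EFinM /poisson exprMn; congr (_%:E); ring.
Qed.

Lemma poisson_total t : 0 <= t -> average (poisson t) (fun=> 1%E) = 1%E.
Proof.
move=> t0; have := average_poisson_geometric t0 ler01.
rewrite subrr mul0r expR0; apply: etrans.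
by apply: congr1; apply/funext => k; rewrite expr1n.
Qed.

(** The total weight of the pairs with j + k = n is an instance of the binomial
    formula for (s + t)^n. *)
Lemma poisson_convolution (s t : R) (u : nat -> R) : 0 <= s -> 0 <= t ->
  (forall n, 0 <= u n) ->
  average (poisson (s + t)) (fun n => (u n)%:E) =
  average (poisson s) (fun j => average (poisson t) (fun k => (u (j + k)%N)%:E)).
Proof.
move=> s0 t0 u0.
pose K (j n : nat) : R := if (j <= n)%N then poisson t (n - j) else 0.
have K0 j n : 0 <= K j n by rewrite /K; case: ifP => // _; exact: poisson_ge0.
rewrite (average_mixture (p := poisson s) (K := K)) => //.
- apply: congr1; apply/funext => j; rewrite /average.
  rewrite (esumID [set n | (j <= n)%N]); last first.
    by move=> n _; rewrite mule_ge0 ?lee_fin.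
  rewrite setTI [X in (_ + X)%E]esum1 ?adde0; last first.
    by move=> n [_ /= /negP/negbTE jn]; rewrite /K jn mul0e.
  rewrite (@reindex_esum R _ _ setT _ (addn j))//.
    by apply: eq_esum => k _; rewrite /K leq_addr addKn.
  split=> [k _ /=|k l _ _|n /= jn]; first exact: leq_addr.
    exact: addnI.
  by exists (n - j)%N => //; rewrite subnKC.
- by move=> j; exact: poisson_ge0.
- move=> n.
  rewrite (average_fset (F := seq_fset tt (iota 0 n.+1)))//; last 2 first.
  + by move=> j; exact: poisson_ge0.
  + by move=> j; rewrite seq_fsetE mem_iota add0n /= ltnS /K => /negbTE->; rewrite mulr0.
  rewrite (perm_big (iota 0 n.+1)); last first.
    by apply: uniq_perm; rewrite ?fset_uniq ?iota_uniq// => j; rewrite seq_fsetE.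
  rewrite -[iota 0 n.+1]/(index_iota 0 n.+1) big_mkord; congr (_%:E).
  rewrite /poisson opprD expRD exprDn mulr_suml mulr_sumr.
  rewrite [LHS](reindex_inj rev_ord_inj)/=.
  apply: eq_bigr => -[j jn] _ /=; rewrite ltnS in jn.
  rewrite /K jn /poisson subSS subKn// bin_sub// -mulr_natr.
  have [fn fj fnj] : [/\ (n`!%:R : R) != 0, (j`!%:R : R) != 0 & ((n - j)`!%:R : R) != 0].
    by split; rewrite pnatr_eq0 -lt0n fact_gt0.
  have -> : ('C(n, j)%:R : R) = n`!%:R / (j`!%:R * (n - j)`!%:R).
    apply: (canRL (mulfK _)); first by rewrite mulf_neq0.
    by rewrite -!natrM bin_fact.
  by field; rewrite fn fj fnj.
Qed.

End Poisson.

Section HeatKernel.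
Context {R : realType} {V : choiceType} {G : simple_graph V}.
Hypothesis lf : locally_finite G.
Hypothesis deg_gt0 : forall x, (0 < deg G x)%N.

Local Notation Pn := (@walk_kernel_pow R V G).
Local Notation Pt := (@heat_kernel R V G).
Local Notation m x := ((deg G x)%:R : R).

Lemma heat_kernelE t x y : 0 <= t ->
  (Pt t x y)%:E = average (poisson t) (fun k => (Pn k x y)%:E).
Proof.
move=> t0; rewrite /heat_kernel EFinM.
have c0 k : 0 <= t ^+ k / k`!%:R * Pn k x y.
  by rewrite mulr_ge0// ?walk_kernel_pow_ge0// divr_ge0// exprn_ge0.
have cv : cvgn (series (fun k => t ^+ k / k`!%:R * Pn k x y)).
  apply: (series_le_cvg c0 (v_ := exp_coeff t)).
  - by move=> k; rewrite divr_ge0// exprn_ge0.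
  - by move=> k; rewrite ler_piMr ?walk_kernel_pow_le1// divr_ge0// exprn_ge0.
  - exact: is_cvg_series_exp_coeff.
have -> : ((limn (series (fun k => t ^+ k / k`!%:R * Pn k x y)))%:E =
    \sum_(0 <= k <oo) (t ^+ k / k`!%:R * Pn k x y)%:E)%E.
  by rewrite -EFin_lim//; apply: congr_lim; apply/funext => n; rewrite sumEFin.
rewrite nneseries_esumT => [|k]; last by rewrite lee_fin.
rewrite -esumZl ?expR_ge0//.
by apply: eq_esum => k _; rewrite -!EFinM /poisson !mulrA.
Qed.

Lemma heat_kernel_ge0 t x y : 0 <= t -> 0 <= Pt t x y.
Proof.
move=> t0; rewrite -lee_fin heat_kernelE// average_ge0// => k.
  exact: poisson_ge0.
by rewrite lee_fin walk_kernel_pow_ge0.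
Qed.

(** Averages of the continuous-time walk are obtained by conditioning on the
    number of jumps before time t. *)
Lemma average_heat_kernel t x (g : V -> \bar R) : 0 <= t ->
  (forall z, (0 <= g z)%E) ->
  average (Pt t x) g = average (poisson t) (fun k => average (Pn k x) g).
Proof.
move=> t0 g0; apply: average_mixture => //.
- by move=> k; exact: poisson_ge0.
- by move=> k z; exact: walk_kernel_pow_ge0.
- by move=> z; exact: heat_kernelE.
Qed.

Lemma heat_kernel_stochastic t x : 0 <= t -> average (Pt t x) (fun=> 1%E) = 1%E.
Proof.
move=> t0; rewrite average_heat_kernel// -[RHS](poisson_total t0).
by apply: congr1; apply/funext => k; exact: walk_kernel_pow_stochastic.
Qed.

Lemma heat_kernel_le1 t x y : 0 <= t -> Pt t x y <= 1.
Proof.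
move=> t0; rewrite -lee_fin -(heat_kernel_stochastic x t0) -[leLHS]mule1.
by apply: (average_ge_term (g := fun=> 1%E)) => // z; exact: heat_kernel_ge0.
Qed.

Lemma heat_kernelD s t x z : 0 <= s -> 0 <= t ->
  (Pt (s + t) x z)%:E = average (Pt s x) (fun y => (Pt t y z)%:E).
Proof.
move=> s0 t0; rewrite average_heat_kernel//; last first.
  by move=> y; rewrite lee_fin heat_kernel_ge0.
rewrite heat_kernelE ?addr_ge0// poisson_convolution//; last first.
  by move=> n; exact: walk_kernel_pow_ge0.
apply: congr1; apply/funext => j.
transitivity (average (Pn j x)
    (fun y => average (poisson t) (fun k => (Pn k y z)%:E))); last first.
  by apply: congr1; apply/funext => y; rewrite heat_kernelE.
rewrite average_exchange.
- by apply: congr1; apply/funext => k; exact: walk_kernel_powD.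
- by move=> y; exact: walk_kernel_pow_ge0.
- by move=> k; exact: poisson_ge0.
- by move=> y k; exact: walk_kernel_pow_ge0.
Qed.

Lemma heat_kernel_reversible t x y : 0 <= t -> m x * Pt t x y = m y * Pt t y x.
Proof.
move=> t0; apply: EFin_inj.
rewrite (EFinM (m x)) (EFinM (m y)) !heat_kernelE//.
have p0 k : 0 <= poisson t k by exact: poisson_ge0.
have pn0 z w k : (0 <= (Pn k z w)%:E)%E by rewrite lee_fin walk_kernel_pow_ge0.
rewrite -!averageZl//; apply: congr1; apply/funext => k.
by rewrite -!EFinM walk_kernel_pow_reversible.
Qed.

Lemma heat_kernel_ge t x y k : 0 <= t -> poisson t k * Pn k x y <= Pt t x y.
Proof.
move=> t0; rewrite -lee_fin heat_kernelE// EFinM.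
apply: (average_ge_term (g := fun k => (Pn k x y)%:E)) => [j|j].
  exact: poisson_ge0.
by rewrite lee_fin walk_kernel_pow_ge0.
Qed.

Hypothesis conn : connected_graph G.

Lemma heat_kernel_gt0 t x y : 0 < t -> 0 < Pt t x y.
Proof.
move=> t0; apply: lt_le_trans (heat_kernel_ge x y (dist G x y) (ltW t0)).
rewrite mulr_gt0 ?(walk_kernel_pow_dist_gt0 lf)// /poisson.
by rewrite mulr_gt0 ?expR_gt0// divr_gt0 ?exprn_gt0// ltr0n fact_gt0.
Qed.

(** The distance travelled is at most the number of jumps. *)
Lemma average_dist_geometric t x (a : R) : 0 <= t -> 1 <= a ->
  (average (Pt t x) (fun y => (a ^+ dist G x y)%:E) <= (expR ((a - 1) * t))%:E)%E.
Proof.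
move=> t0 a1; have a0 : 0 <= a by apply: le_trans a1.
have ak k : 0 <= a ^+ k by exact: exprn_ge0.
rewrite average_heat_kernel// => [|z]; last by rewrite lee_fin.
rewrite -average_poisson_geometric//; apply: le_average => k.
  exact: poisson_ge0.
move=> _; rewrite -[leRHS](@average_cst _ _ (Pn k x))//; last 2 first.
- by move=> z; exact: walk_kernel_pow_ge0.
- exact: walk_kernel_pow_stochastic.
apply: le_average => [z|z pz]; first exact: walk_kernel_pow_ge0.
by rewrite lee_fin ler_weXn2l// (dist_le lf deg_gt0 pz).
Qed.

End HeatKernel.

(** * Chebyshev polynomials of a reversible kernel *)

Section Chebyshev.
Context {R : realType} {E : finType}.
Variables (m : E -> R) (c : E -> E -> R).
Hypothesis m_gt0 : forall x, 0 < m x.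
Hypothesis c_ge0 : forall x y, 0 <= c x y.
Hypothesis c_sym : forall x y, c x y = c y x.
Hypothesis c_sub : forall x, \sum_y c x y <= m x.

Definition kernel_op (f : E -> R) : E -> R :=
  fun x => \sum_y c x y / m x * f y.

Definition dot (f g : E -> R) : R := \sum_x m x * f x * g x.

Local Notation op := kernel_op.

Lemma kernel_opD f g : op (f \+ g) = op f \+ op g.
Proof.
by apply/funext => x; rewrite /op /= -big_split; apply: eq_bigr => y _; rewrite mulrDr.
Qed.

Lemma kernel_opB f g : op (f \- g) = op f \- op g.
Proof.
apply/funext => x; rewrite /op /= -sumrB; apply: eq_bigr => y _.
by rewrite mulrBr.
Qed.

Lemma kernel_op0 : op (fun=> 0) = (fun=> 0).
Proof. by apply/funext => x; rewrite /op big1// => y _; rewrite mulr0. Qed.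

Lemma dotC f g : dot f g = dot g f.
Proof. by apply: eq_bigr => x _; rewrite mulrAC. Qed.

Lemma dotDl f g h : dot (f \+ g) h = dot f h + dot g h.
Proof. by rewrite /dot -big_split; apply: eq_bigr => x _ /=; rewrite mulrDr mulrDl. Qed.

Lemma dotBl f g h : dot (f \- g) h = dot f h - dot g h.
Proof. by rewrite /dot -sumrB; apply: eq_bigr => x _ /=; rewrite mulrBr mulrBl. Qed.

Lemma dotDr f g h : dot h (f \+ g) = dot h f + dot h g.
Proof. by rewrite dotC dotDl !(dotC h). Qed.

Lemma dotBr f g h : dot h (f \- g) = dot h f - dot h g.
Proof. by rewrite dotC dotBl !(dotC h). Qed.

Lemma dot_kernel_op f g : dot (op f) g = \sum_x \sum_y c x y * (f y * g x).
Proof.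
apply: eq_bigr => x _; rewrite /op mulr_sumr mulr_suml; apply: eq_bigr => y _.
by field; rewrite gt_eqF.
Qed.

Lemma dot_kernel_op_sym f g : dot (op f) g = dot f (op g).
Proof.
rewrite [RHS]dotC !dot_kernel_op exchange_big; apply: eq_bigr => x _.
by apply: eq_bigr => y _; rewrite c_sym mulrC [X in X * _]mulrC mulrC.
Qed.

(** By a b <= (a^2 + b^2)/2 on each edge, <P f, g> <= (|f|^2 + |g|^2)/2 for all
    g, in particular for g = P f. *)
Lemma kernel_op_contraction f : dot (op f) (op f) <= dot f f.
Proof.
suff H g : dot (op f) g <= (dot f f + dot g g) / 2 by have := H (op f); lra.
have sum_le h : \sum_x \sum_y c x y * h x ^+ 2 <= dot h h.
  apply: ler_sum => x _; rewrite -mulr_suml -mulrA -expr2.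
  by rewrite ler_wpM2r// sqr_ge0.
rewrite dot_kernel_op; apply: le_trans
  (_ : (\sum_x \sum_y c x y * f x ^+ 2 + \sum_x \sum_y c x y * g x ^+ 2) / 2 <= _);
  last by rewrite ler_pM2r ?invr_gt0// lerD.
rewrite [X in X + _]exchange_big -big_split mulr_suml; apply: ler_sum => x _ /=.
rewrite -big_split mulr_suml; apply: ler_sum => y _ /=.
rewrite (c_sym y x) -mulrDr -mulrA ler_wpM2l//.
by have := sqr_ge0 (f y - g x); rewrite sqrrB; lra.
Qed.

Variable v : E -> R.

(** The j-th pair is (T_j(P) v, U_(j-1)(P) v), for the Chebyshev polynomials of
    the first and second kinds. *)
Fixpoint chebyshev (j : nat) : (E -> R) * (E -> R) :=
  if j is i.+1 then
    let: (a, b) := chebyshev i in (op a \- b \+ op (op b), op b \+ a)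
  else (v, fun=> 0).

Local Notation T j := (chebyshev j).1.
Local Notation U j := (chebyshev j).2.

Lemma chebyshevS j :
  chebyshev j.+1 = (op (T j) \- U j \+ op (op (U j)), op (U j) \+ T j).
Proof. by rewrite /=; case: (chebyshev j). Qed.

Lemma chebyshev1 : T 1 = op v.
Proof. by rewrite chebyshevS/= !kernel_op0; apply/funext => x /=; rewrite subr0 addr0. Qed.

Lemma chebyshev_rec j : op (T j.+1) = fun x => (T j.+2 x + T j x) / 2.
Proof.
rewrite (chebyshevS j.+1) (chebyshevS j) /= !(kernel_opD, kernel_opB).
by apply/funext => x /=; field.
Qed.

(** Pell's identity T_j^2 + (1 - P^2) U_(j-1)^2 = 1, tested against v. It shows
    that T_j(P) is a contraction without any spectral theory, since 1 - P^2 is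
    nonnegative. *)
Lemma chebyshev_pell j :
  dot (T j) (T j) + dot (U j) (U j) - dot (op (U j)) (op (U j)) = dot v v.
Proof.
elim: j => [|j IH].
  rewrite /= kernel_op0 [dot (fun=> 0) _]big1 ?subr0 ?addr0// => x _.
  by rewrite mulr0.
rewrite chebyshevS /= -{}IH; move: (T j) (U j) => a b.
rewrite !kernel_opD !(dotDl, dotBl, dotDr, dotBr).
rewrite (dotC b (op a)) (dotC (op (op b)) (op a)) (dotC a (op b)).
rewrite (dot_kernel_op_sym a b) (dot_kernel_op_sym (op b) b) (dotC (op b) a).
by rewrite (dotC b (op (op b))) (dot_kernel_op_sym (op b) b); ring.
Qed.

Lemma dot_chebyshev_le j : dot (T j) (T j) <= dot v v.
Proof. by have := chebyshev_pell j; have := kernel_op_contraction (U j); lra. Qed.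

(** Twice cosh (l j), that is, twice the value of T_j at cosh l. *)
Definition cosh2 (l : R) (j : nat) : R := expR (l * j%:R) + expR (- (l * j%:R)).

Lemma cosh2_rec l j :
  (cosh2 l j.+2 + cosh2 l j) / 2 = cosh2 l 1 / 2 * cosh2 l j.+1.
Proof.
rewrite mulrAC; congr (_ / 2); rewrite /cosh2 mulrDl !mulrDr -!expRD.
have -> : l * 1%:R + l * j.+1%:R = l * j.+2%:R by rewrite -mulrDr -natrD add1n.
have -> : l * 1%:R - l * j.+1%:R = - (l * j%:R) by rewrite -[j.+1]add1n natrD; ring.
have -> : - (l * 1%:R) + l * j.+1%:R = l * j%:R by rewrite -[j.+1]add1n natrD; ring.
have -> : - (l * 1%:R) - l * j.+1%:R = - (l * j.+2%:R).
  by rewrite -opprD -mulrDr -natrD add1n.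
ring.
Qed.

Variables (x : E) (d : nat).
Hypothesis far : forall i, (i < d)%N -> iter i op v x = 0.

Lemma iter_kernel_opD k f g : iter k op (f \+ g) = iter k op f \+ iter k op g.
Proof. by elim: k => //= k ->; rewrite kernel_opD. Qed.

Lemma iter_kernel_opZ k a f :
  iter k op (fun x => f x * a) = fun x => iter k op f x * a.
Proof.
elim: k => //= k ->; apply/funext => y; rewrite /op mulr_suml.
by apply: eq_bigr => z _; rewrite mulrA.
Qed.

Lemma iter_kernel_op_chebyshev k j : iter k.+1 op (T j.+1) =
  fun x => (iter k op (T j.+2) x + iter k op (T j) x) / 2.
Proof.
by rewrite iterSr chebyshev_rec (iter_kernel_opZ k _ (T j.+2 \+ T j)) iter_kernel_opD.
Qed.

Lemma chebyshev_far k j : (k + j < d)%N -> iter k op (T j) x = 0.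
Proof.
elim/ltn_ind: j k => -[|[|j]] IH k kd.
- by apply: far; rewrite addn0 in kd.
- by rewrite chebyshev1 -iterSr far// -addn1.
have := iter_kernel_op_chebyshev k j => /(congr1 (fun f => f x)).
rewrite (IH j.+1)// ?addSnnS// (IH j)//; last first.
  by apply: leq_ltn_trans kd; rewrite leq_add2l leqW.
by move/eqP; rewrite addr0 eq_sym mulf_eq0 invr_eq0 pnatr_eq0 orbF => /eqP.
Qed.

(** Carne's argument: P^k is the average of T_(|S_k|)(P) for a simple random
    walk S on the integers, T_j(P) has range j, and it is a contraction, whence
    |T_j(P) v| <= N at x. The induction on k
    applies P to T_j(P) v by means of 2 X T_(j+1) = T_(j+2) + T_j, and the recursion of the
    numbers cosh (l j) matches this one. *)
Lemma carne (N l : R) k : 0 <= N -> 0 <= l -> dot v v <= m x * N ^+ 2 ->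
  `|iter k op v x| * expR (l * d%:R) <= 2 * N * (cosh2 l 1 / 2) ^+ k.
Proof.
move=> N0 l0 vN.
have cosh20 : cosh2 l 0 = 2 by rewrite /cosh2 mulr0 oppr0 expR0.
suff /(_ 0%N) : forall j, `|iter k op (T j) x| * expR (l * d%:R) <=
    N * (cosh2 l 1 / 2) ^+ k * cosh2 l j.
  by rewrite cosh20 /= => /le_trans; apply; rewrite mulrC mulrA.
elim: k => [|k IH] j.
  rewrite expr0 mulr1; case: (ltnP j d) => [jd|dj].
    rewrite chebyshev_far ?normr0 ?mul0r// mulr_ge0// addr_ge0// expR_ge0//.
  have e0 : 0 <= expR (l * d%:R) by exact: expR_ge0.
  apply: ler_pM => //; last first.
    apply: ler_wpDr; first exact: expR_ge0.
    by rewrite ler_expR ler_wpM2l// ler_nat.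
  rewrite -(@ler_pXn2r _ 2)// ?nnegrE// -normrX ger0_norm ?sqr_ge0//.
  rewrite -(ler_pM2l (m_gt0 x)); apply: le_trans (le_trans (dot_chebyshev_le j) vN).
  rewrite /dot (bigD1 x)//= -mulrA -expr2 lerDl sumr_ge0// => y _.
  by rewrite -mulrA -expr2 mulr_ge0 ?sqr_ge0 ?ltW.
case: j => [|j].
  rewrite iterSr -chebyshev1; apply: le_trans (IH 1%N) _.
  by rewrite exprS cosh20 le_eqVlt; apply/orP; left; apply/eqP; field.
rewrite iter_kernel_op_chebyshev exprS.
have := IH j.+2; have := IH j; set e := expR _.
set p := iter k op (T j.+2) x; set q := iter k op _ x => Hq Hp.
have -> : N * (cosh2 l 1 / 2 * (cosh2 l 1 / 2) ^+ k) * cosh2 l j.+1 =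
   N * (cosh2 l 1 / 2) ^+ k * (cosh2 l 1 / 2 * cosh2 l j.+1) by ring.
rewrite -cosh2_rec normrM (ger0_norm (_ : 0 <= 2^-1)) ?invr_ge0//.
have e0 : 0 <= e by exact: expR_ge0.
have := ler_wpM2r e0 (ler_normD p q); rewrite mulrDl; lra.
Qed.

End Chebyshev.

(** * Off-diagonal decay of the heat kernel *)

Section ExponentialBounds.
Context {R : realType}.

Lemma expR_le_invB (u : R) : u < 1 -> expR u <= (1 - u)^-1.
Proof.
move=> u1; rewrite -[leLHS]invrK -expRN lef_pV2 ?posrE ?expR_gt0 ?subr_gt0//.
exact: expR_ge1Dx.
Qed.

(** This is cosh l - 1 = O(l^2). *)
Lemma cosh2_le (l : R) : 0 <= l -> l <= 2^-1 -> cosh2 l 1 / 2 - 1 <= 3 / 2 * l ^+ 2.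
Proof.
move=> l0 l1; rewrite /cosh2 mulr1.
have H1 : expR l <= 1 + l + 2 * l ^+ 2.
  apply: le_trans (expR_le_invB _) _; first by lra.
  rewrite -div1r ler_pdivrMr; last by lra.
  have : 0 <= l ^+ 2 * (1 - 2 * l) by rewrite mulr_ge0 ?sqr_ge0//; lra.
  by rewrite expr2; nra.
have H2 : expR (- l) <= 1 - l + l ^+ 2.
  apply: le_trans (expR_le_invB _) _; first by lra.
  rewrite opprK -div1r ler_pdivrMr; last by lra.
  have : 0 <= l ^+ 3 by rewrite exprn_ge0.
  by rewrite !exprS expr0; nra.
lra.
Qed.

Lemma sqr_le_expR (u : R) : 0 <= u -> u ^+ 2 <= 4 * expR u.
Proof.
move=> u0; have -> : expR u = expR (u / 2) ^+ 2.
  by rewrite -expRM_natr; congr expR; field.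
have := expR_ge1Dx (u / 2) => h.
have : (u / 2) ^+ 2 <= expR (u / 2) ^+ 2.
  by rewrite ler_pXn2r ?nnegrE ?expR_ge0//; lra.
rewrite expr_div_n; lra.
Qed.

Lemma expR_half_le2 : expR 2^-1 <= 2 :> R.
Proof.
apply: le_trans (expR_le_invB _) _; first by lra.
by rewrite [leLHS](_ : _ = 2)//; field.
Qed.

Lemma expR2_le : expR 2 <= 16 :> R.
Proof.
have -> : (2 : R) = 2^-1 * 4%:R by field.
rewrite expRM_natr; have -> : (16 : R) = 2 ^+ 4 by ring.
by rewrite ler_pXn2r ?nnegrE ?expR_ge0 ?expR_half_le2.
Qed.

End ExponentialBounds.

Section Decay.
Context {R : realType} {V : choiceType} {G : simple_graph V}.
Hypothesis lf : locally_finite G.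
Hypothesis deg_gt0 : forall x, (0 < deg G x)%N.
Hypothesis conn : connected_graph G.

Local Notation P := (walk_kernel R G).
Local Notation Pn := (@walk_kernel_pow R V G).
Local Notation Pt := (@heat_kernel R V G).
Local Notation m x := ((deg G x)%:R : R).

Lemma finite_ball x k : finite_set [set z | (dist G x z <= k)%N].
Proof.
elim: k => [|k IH].
  apply: (@sub_finite_set _ _ [set x]) => // z /=; rewrite leqn0 => /eqP dz.
  have := walk_kernel_pow_dist_gt0 (R := R) lf deg_gt0 conn x z.
  by rewrite dz /=; case: eqP => [->//|]; rewrite ltxx.
apply: (@sub_finite_set _ _ ([set z | (dist G x z <= k)%N] `|`
   \bigcup_(y in [set z | (dist G x z <= k)%N]) neighbours G y)).
  move=> z /=; rewrite leq_eqVlt => /orP[/eqP dz|]; last by left.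
  right; have := walk_kernel_pow_dist_gt0 (R := R) lf deg_gt0 conn x z.
  rewrite dz -lte_fin -addn1 walk_kernel_powD// => pos.
  suff [y [xy yz]] : exists y, 0 < Pn k x y /\ 0 < P y z.
    exists y => /=; first exact: dist_le xy.
    by move: yz; rewrite /walk_kernel; case: ifP => //; rewrite ltxx.
  apply: contrapT => no; move: pos; rewrite /average esum1 ?ltxx// => y _.
  rewrite -EFinM walk_kernel_pow1//.
  have := @walk_kernel_pow_ge0 R V G k x y; rewrite le_eqVlt => /predU1P[<-|xy].
    by rewrite mul0r.
  have := walk_kernel_ge0 (R := R) (G := G) y z; rewrite le_eqVlt => /predU1P[<-|yz].
    by rewrite mulr0.
  by case: no; exists y.
rewrite finite_setU; split => //.
by apply: bigcup_finite => // y _; exact: lf.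
Qed.

Lemma dist0 x : dist G x x = 0%N.
Proof. by apply/eqP; rewrite -leqn0 (dist_le (R := R) lf deg_gt0)//= eqxx. Qed.

(** Only the vertices within distance k of x matter for P^k(x,.), so that Carne's
    bound can be applied to the kernel restricted to the finite set E. *)
Lemma walk_kernel_pow_decay (l : R) x y k : 0 <= l ->
  Pn k x y * expR (l * (dist G x y)%:R) <= 2 * m y * (cosh2 l 1 / 2) ^+ k.
Proof.
move=> l0; have [kd|dk] := ltnP k (dist G x y).
  have -> : Pn k x y = 0.
    apply/eqP; rewrite eq_le walk_kernel_pow_ge0 andbT leNgt.
    by apply/negP => /(dist_le lf deg_gt0); rewrite leqNgt kd.
  by rewrite mul0r mulr_ge0// exprn_ge0// divr_ge0// addr_ge0// expR_ge0.
pose E := fset_set [set z | (dist G x z <= k)%N].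
have inE_ z : (z \in E) = (dist G x z <= k)%N.
  by rewrite in_fset_set ?inE//; [apply/idP/idP; rewrite inE|exact: finite_ball].
have xE : x \in E by rewrite inE_ dist0.
have yE : y \in E by rewrite inE_.
pose mE (e : E) := m (val e).
pose c (e f : E) : R := (adj G (val e) (val f))%:R.
pose v (e : E) : R := (val e == y)%:R.
have mE0 e : 0 < mE e by exact: degR_gt0.
have c0 e f : 0 <= c e f by [].
have c_sym e f : c e f = c f e by rewrite /c adj_sym.
have c_sub e : \sum_f c e f <= mE e.
  rewrite -(big_seq_fsetE _ _ xpredT (fun z => (adj G (val e) z)%:R)) /=.
  rewrite -natr_sum ler_nat.
  rewrite (eq_bigr (fun z => if adj G (val e) z then 1%N else 0%N)); last first.
    by move=> z _; case: (adj _ _ _).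
  rewrite -big_mkcond sum1_count -size_filter uniq_leq_size ?filter_uniq//.
  by move=> z; rewrite mem_filter => /andP[ez _]; rewrite in_neighbours.
have ball_step (z w : V) i : (dist G x z + i.+1 <= k)%N -> adj G z w ->
    (dist G x w + i <= k)%N.
  move=> zk /(dist_adj (R := R) lf deg_gt0) zw; apply: leq_trans zk.
  rewrite addnS -addSn leq_add2r -addn1.
  apply: leq_trans (dist_triangle (R := R) lf deg_gt0 conn x z w) _.
  by rewrite leq_add2l.
have transfer i (z : E) : (dist G x (val z) + i <= k)%N ->
    iter i (kernel_op mE c) v z = Pn i (val z) y.
  elim: i z => [|i IH] z dz //.
  rewrite [RHS](fsbigTE E) => [|w]; last first.
    rewrite inE_ -ltnNge => kw; rewrite /walk_kernel; case: ifP; rewrite ?mul0r// => zw.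
    have := leq_trans (leq_addr _ _) (ball_step _ _ _ dz zw).
    by rewrite leqNgt kw.
  rewrite iterS /kernel_op big_seq_fsetE; apply: eq_bigr => w _.
  rewrite /c /walk_kernel; case: ifP => zw; last by rewrite !mul0r.
  by rewrite mul1r IH//; exact: ball_step dz zw.
(* For v the indicator of y, |v|^2 = m y <= m x * (m y)^2, hence N = m y. *)
have := @carne R E mE c mE0 c0 c_sym c_sub v [` xE]%fset (dist G x y) _ (m y) l k _ l0 _.
rewrite transfer; last by rewrite /= dist0.
rewrite ger0_norm ?walk_kernel_pow_ge0//; apply => //.
- move=> i idx; rewrite transfer/= ?dist0 ?add0n; last exact: leq_trans (ltnW idx) dk.
  apply/eqP; rewrite eq_le walk_kernel_pow_ge0 andbT leNgt.
  by apply/negP => /(dist_le lf deg_gt0); rewrite leqNgt idx.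
- rewrite /dot (bigD1 [` yE]%fset)//= big1 ?addr0 => [|e ey]; last first.
    rewrite /v; case: eqP => [e_y|]; last by rewrite mulr0.
    by case/eqP: ey; apply: val_inj.
  rewrite /v /= eqxx !mulr1 /mE /=.
  rewrite expr2 mulrA ler_peMl ?mulr_ege1 ?degR_ge1// ltW ?degR_gt0//.
Qed.

Lemma heat_kernel_decay (l t : R) x y : 0 <= t -> 0 <= l ->
  Pt t x y * expR (l * (dist G x y)%:R) <=
  2 * m y * expR ((cosh2 l 1 / 2 - 1) * t).
Proof.
move=> t0 l0; have e0 : 0 <= expR (l * (dist G x y)%:R) by exact: expR_ge0.
have c0 : 0 <= cosh2 l 1 / 2 by rewrite divr_ge0// addr_ge0// expR_ge0.
have my0 : 0 <= 2 * m y by [].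
have p0 k : 0 <= poisson t k by exact: poisson_ge0.
rewrite -lee_fin (mulrC (Pt t x y)) (EFinM (expR _)) (EFinM (2 * m y)).
rewrite heat_kernelE// -(average_poisson_geometric t0 c0).
rewrite -!averageZl//; last 2 first.
- by move=> k; rewrite lee_fin exprn_ge0.
- by move=> k; rewrite lee_fin walk_kernel_pow_ge0.
apply: le_average => // k _.
by rewrite -!EFinM lee_fin mulrC walk_kernel_pow_decay.
Qed.

(** * Entropy controls displacement *)

(** The density P_t(x,z)/m(z) is symmetric, and at most 1 because m >= 1. *)
Definition surprisal (t : R) (x z : V) : R := - ln (Pt t x z / m z).

Lemma surprisal_ge0 t x z : 0 < t -> 0 <= surprisal t x z.
Proof.
move=> t0; rewrite /surprisal oppr_ge0 ln_le0//.
rewrite ler_pdivrMr ?degR_gt0// mul1r.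
exact: le_trans (heat_kernel_le1 lf deg_gt0 x z (ltW t0)) (degR_ge1 deg_gt0 z).
Qed.

Lemma surprisal_sym t x z : 0 < t -> surprisal t x z = surprisal t z x.
Proof.
move=> t0; rewrite /surprisal; congr (- ln _).
apply: (canRL (mulfK _)); first by rewrite gt_eqF ?degR_gt0.
rewrite mulrAC; apply: (canLR (mulfK _)); first by rewrite gt_eqF ?degR_gt0.
by rewrite mulrC (heat_kernel_reversible lf deg_gt0)// 1?mulrC// ltW.
Qed.

Lemma surprisal_ge (l t : R) x z : 0 < t -> 0 <= l -> l <= 2^-1 ->
  l * (dist G x z)%:R - 3 / 2 * l ^+ 2 * t - 1 <= surprisal t x z.
Proof.
move=> t0 l0 l1.
have q0 : 0 < Pt t x z / m z.
  by rewrite divr_gt0 ?degR_gt0// heat_kernel_gt0.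
have : ln (Pt t x z / m z) <= ln (2 * expR (3 / 2 * l ^+ 2 * t - l * (dist G x z)%:R)).
  rewrite ler_ln ?posrE//; last by rewrite mulr_gt0 ?expR_gt0.
  rewrite ler_pdivrMr ?degR_gt0// expRB mulrA mulrAC ler_pdivlMr ?expR_gt0//.
  apply: le_trans (heat_kernel_decay x z (ltW t0) l0) _.
  have t0' := ltW t0.
  by rewrite [leRHS]mulrAC ler_wpM2l// ler_expR ler_wpM2r// cosh2_le.
rewrite [ln (2 * _)]lnM ?posrE ?expR_gt0// expRK /surprisal.
have : ln 2 <= 1 :> R by have := @le_ln1Dx R 1; rewrite (_ : 1 + 1 = 2)//; apply; lra.
lra.
Qed.

(** Within distance 16 t, the slope l = d/(32 t) in the off-diagonal decay gives
    a Gaussian bound. The last term takes care of larger distances; the rate 16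
    is chosen so that e^2 - 1 <= 16, which bounds the average of that term. *)
Lemma sqr_dist_le t x z : 0 < t ->
  (dist G x z)%:R ^+ 2 <= 64 * t * (surprisal t x z + 1) +
    4 * expR (- (16 * t)) * expR 2 ^+ dist G x z.
Proof.
move=> t0; set d : R := (dist G x z)%:R.
have d0 : 0 <= d by [].
have s0 := surprisal_ge0 x z t0.
have [dt|td] := lerP d (16 * t).
  have l0 : 0 <= d / (32 * t) by rewrite divr_ge0// mulr_ge0// ltW.
  have l1 : d / (32 * t) <= 2^-1.
    by rewrite ler_pdivrMr ?mulr_gt0//; lra.
  have := surprisal_ge x z t0 l0 l1; rewrite -/d.
  have -> : d / (32 * t) * d - 3 / 2 * (d / (32 * t)) ^+ 2 * t - 1 =
      d ^+ 2 / t * (61 / 2048) - 1 by field; rewrite gt_eqF.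
  move=> h; apply: ler_wpDr.
    by rewrite !mulr_ge0 ?expR_ge0 ?exprn_ge0.
  have dt0 : 0 <= d ^+ 2 / t by rewrite divr_ge0 ?sqr_ge0 ?ltW.
  have -> : d ^+ 2 = d ^+ 2 / t * t by rewrite divfK// gt_eqF.
  rewrite [leRHS]mulrAC ler_pM2r//; lra.
apply: ler_wpDl; first by rewrite mulr_ge0 ?addr_ge0// mulr_ge0// ltW.
apply: le_trans (sqr_le_expR d0) _.
rewrite -mulrA ler_pM2l// -expRM_natr -expRD ler_expR -/d; lra.
Qed.

Definition second_moment (t : R) (x : V) : \bar R :=
  average (Pt t x) (fun z => ((dist G x z)%:R ^+ 2)%:E).

Definition entropy (t : R) (x : V) : \bar R :=
  average (Pt t x) (fun z => (surprisal t x z)%:E).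

Lemma average_expR2_dist t x : 0 <= t ->
  (average (Pt t x) (fun z => (expR 2 ^+ dist G x z)%:E) <= (expR (16 * t))%:E)%E.
Proof.
move=> t0; apply: le_trans (average_dist_geometric lf deg_gt0 x t0 _) _.
  by rewrite ltW// expR_gt1.
by rewrite lee_fin ler_expR ler_wpM2r//; have := @expR2_le R; lra.
Qed.

(** A walk that has travelled far sits at a place of large surprisal. *)
Lemma second_moment_le t x (H : R) : 0 < t -> (entropy t x <= H%:E)%E ->
  (second_moment t x <= (64 * t * (H + 1) + 4)%:E)%E.
Proof.
move=> t0 tH; have t0' := ltW t0.
have p0 z : 0 <= Pt t x z by exact: heat_kernel_ge0.
have s0 z : 0 <= surprisal t x z by exact: surprisal_ge0.
have e0 z : 0 <= expR 2 ^+ dist G x z by rewrite exprn_ge0 ?expR_ge0.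
have c0 : 0 <= 64 * t by rewrite mulr_ge0.
have c1 : 0 <= 4 * expR (- (16 * t)) by rewrite mulr_ge0// expR_ge0.
apply: (@le_trans _ _ (average (Pt t x) (fun z =>
    ((64 * t)%:E * ((surprisal t x z)%:E + 1)) +
    ((4 * expR (- (16 * t)))%:E * (expR 2 ^+ dist G x z)%:E)))%E).
  by apply: le_average => // z _; rewrite -!EFinM -!EFinD lee_fin sqr_dist_le.
have s1 z : (0 <= (surprisal t x z)%:E + 1)%E by rewrite adde_ge0// lee_fin.
rewrite averageD => [||z|z]//; try by rewrite mule_ge0// lee_fin.
rewrite !averageZl// averageD// (EFinD (_ * _) 4) (EFinM (64 * t)).
apply: leeD.
  rewrite lee_wpmul2l ?lee_fin// EFinD leeD//.
  by rewrite heat_kernel_stochastic.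
apply: le_trans (lee_wpmul2l _ (average_expR2_dist x t0')) _.
  by rewrite lee_fin.
by rewrite -EFinM lee_fin -mulrA -expRD addNr expR0 mulr1.
Qed.

End Decay.

(** * Consequences of the log-Harnack inequality *)

Section LogHarnack.
Context {R : realType} {V : choiceType} {G : simple_graph V}.
Hypothesis lf : locally_finite G.
Hypothesis deg_gt0 : forall x, (0 < deg G x)%N.
Hypothesis conn : connected_graph G.

Local Notation Pn := (@walk_kernel_pow R V G).
Local Notation Pt := (@heat_kernel R V G).
Local Notation m x := ((deg G x)%:R : R).
Local Notation surprisal := (@surprisal R V G).
Local Notation entropy := (@entropy R V G).
Local Notation second_moment := (@second_moment R V G).

(** The entropy plus the divergence. Unlike the divergence it is a sum of
    nonnegative terms, to which Tonelli's theorem applies. *)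
Definition cross_entropy (t : R) (x y : V) : \bar R :=
  average (Pt t x) (fun z => (surprisal t y z)%:E).

Lemma heat_entropyE t x : 0 < t -> heat_entropy G t x = entropy t x.
Proof.
move=> t0; rewrite /heat_entropy /signed_sum.
have ps z : 0 <= Pt t x z * surprisal t x z.
  by rewrite mulr_ge0 ?(surprisal_ge0 lf)// heat_kernel_ge0// ltW.
have E z : Pt t x z * ln (Pt t x z / m z) = - (Pt t x z * surprisal t x z).
  by rewrite /surprisal mulrN opprK.
rewrite esum1 => [|z _]; last first.
  by rewrite funeposE E; apply: max_idPr; rewrite lee_fin oppr_le0.
rewrite sub0e oppeK; apply: eq_esum => z _.
by rewrite funenegE E -EFinN opprK -EFinM; apply: max_idPl; rewrite lee_fin.
Qed.

Lemma ln_heat_kernel_ratio t x y z : 0 < t ->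
  ln (Pt t x z / Pt t y z) = surprisal t y z - surprisal t x z.
Proof.
move=> t0; rewrite /surprisal.
have P0 w : 0 < Pt t w z by exact: heat_kernel_gt0.
have m0 : 0 < m z by exact: degR_gt0.
by rewrite !ln_div ?posrE//; ring.
Qed.

Lemma relative_entropy_heat_kernel t x y : 0 < t ->
  relative_entropy (Pt t x) (Pt t y) =
  signed_sum (fun z => (Pt t x z * ln (Pt t x z / Pt t y z))%:E).
Proof.
move=> t0; rewrite /relative_entropy asboolT// => z qz.
by have := heat_kernel_gt0 lf deg_gt0 conn y z t0; rewrite qz ltxx.
Qed.

(** Entropy + positive part of the divergence = cross-entropy + negative part;
    the finiteness of the entropy bounds the negative part, which can therefore
    be cancelled. *)
Lemma cross_entropy_le t x y (H K : R) : 0 < t -> (entropy t x <= H%:E)%E ->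
  (relative_entropy (Pt t x) (Pt t y) <= K%:E)%E ->
  (cross_entropy t x y <= (H + K)%:E)%E.
Proof.
move=> t0 eH; rewrite relative_entropy_heat_kernel// /signed_sum.
pose g z := (Pt t x z * ln (Pt t x z / Pt t y z))%:E; rewrite -/g.
have s0 w z : 0 <= Pt t x z * surprisal t w z.
  by rewrite mulr_ge0 ?(surprisal_ge0 lf)// heat_kernel_ge0// ltW.
have gE z : g z = (Pt t x z * surprisal t y z - Pt t x z * surprisal t x z)%:E.
  by rewrite /g ln_heat_kernel_ratio// mulrBr.
set Sp := esum _ _; set Sn := esum _ (funeneg g) => SK.
have Sn_le : (Sn <= entropy t x)%E.
  apply: le_esum => z _; rewrite funenegE gE -EFinN -EFinM.
  rewrite -[X in maxe _ X]/(0%:E) -EFin_max lee_fin ge_max s0 andbT.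
  by have := s0 y z; lra.
have Sn0 : (0 <= Sn)%E by apply: esum_ge0 => z _; exact: funeneg_ge0.
have Sp0 : (0 <= Sp)%E by apply: esum_ge0 => z _; exact: funepos_ge0.
have Sn_fin : Sn \is a fin_num.
  by rewrite ge0_fin_numE// (le_lt_trans (le_trans Sn_le eH))// ltry.
have balance : (cross_entropy t x y + Sn = entropy t x + Sp)%E.
  rewrite -!esumD//; try by move=> z _; rewrite ?funeneg_ge0 ?funepos_ge0// -?EFinM lee_fin.
  apply: eq_esum => z _; rewrite funenegE funeposE gE -EFinN -!EFinM.
  rewrite -[X in maxe _ X]/(0%:E) -!EFin_max -!EFinD; congr (_%:E).
  by case: (lerP 0 (Pt t x z * surprisal t y z - Pt t x z * surprisal t x z)) => h;
    rewrite ?(max_idPl _ _ _)//; do 2?case: (lerP _ 0); lra.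
rewrite -(leeD2rE _ _ Sn_fin) balance EFinD -addeA; apply: leeD => //.
by rewrite -leeBlDr.
Qed.

(** Jensen's inequality for -ln, from its tangent at S = P_(s+t)(x,z):
    - ln a >= - ln S + 1 - a/S. *)
Lemma surprisal_jensen (s t : R) x z : 0 < s -> 0 < t ->
  ((surprisal (s + t) x z)%:E <=
   average (Pt s x) (fun y => (surprisal t y z)%:E))%E.
Proof.
move=> s0 t0; have st0 : 0 < s + t by rewrite addr_gt0.
have p0 y : 0 <= Pt s x y by rewrite heat_kernel_ge0// ltW.
have m0 : 0 < m z by exact: degR_gt0.
have S0 : 0 < Pt (s + t) x z by exact: heat_kernel_gt0.
set S := Pt _ x z in S0.
have SV0 : 0 <= S^-1 by rewrite invr_ge0 ltW.
have q0 y : 0 <= Pt t y z by rewrite heat_kernel_ge0// ltW.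
have one : average (Pt s x) (fun y => (S^-1)%:E * (Pt t y z)%:E)%E = 1%E.
  rewrite averageZl// -heat_kernelD// ?ltW// -EFinM mulVf//.
  by rewrite gt_eqF.
have c0 : 0 <= surprisal (s + t) x z + 1 by rewrite addr_ge0// (surprisal_ge0 lf).
have f1 : (1%E : \bar R) \is a fin_num by [].
rewrite -(leeD2rE _ _ f1) -[X in (_ <= _ + X)%E]one -averageD//; last 2 first.
- by move=> y; rewrite lee_fin (surprisal_ge0 lf).
- by move=> y; rewrite mule_ge0// lee_fin.
rewrite -EFinD -(@average_cst _ _ (Pt s x))//; last first.
  by rewrite heat_kernel_stochastic// ltW.
apply: le_average => // y _; rewrite -EFinM -EFinD lee_fin /surprisal -/S.
have P0 : 0 < Pt t y z by exact: heat_kernel_gt0.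
have u0 : 0 < S^-1 * Pt t y z by rewrite mulr_gt0 ?invr_gt0.
have h : ln (S^-1 * Pt t y z) <= S^-1 * Pt t y z - 1.
  have := @le_ln1Dx R (S^-1 * Pt t y z - 1); rewrite addrCA subrr addr0; apply.
  by rewrite ltrBrDl subrr.
rewrite lnM ?posrE ?invr_gt0// lnV ?posrE// in h.
by rewrite !ln_div ?posrE//; lra.
Qed.

Lemma second_moment_ge0 t x : 0 <= t -> (0 <= second_moment t x)%E.
Proof.
move=> t0; apply: average_ge0 => z; first exact: heat_kernel_ge0.
by rewrite lee_fin sqr_ge0.
Qed.

(** Let y and y' be independent copies of X_s. The point z = X_(s+t) is drawn
    from P_t(y,.), and by Jensen's inequality its surprisal is at most the
    average over y' of the surprisal of z for P_t(y',.). So H_(s+t)(x) is at most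
    the average of the cross-entropy, and
    dist(y,y')^2 <= 2 dist(x,y)^2 + 2 dist(x,y')^2. *)
Lemma entropyD_le (s t : R) x (a b M : R) : 0 < s -> 0 < t -> 0 <= a -> 0 <= b ->
  (forall y y', (cross_entropy t y y' <=
     (a + b * (dist G y y')%:R ^+ 2)%:E)%E) ->
  (second_moment s x <= M%:E)%E ->
  (entropy (s + t) x <= (a + 4 * b * M)%:E)%E.
Proof.
move=> s0 t0 a0 b0 crossH MH.
have st0 : 0 < s + t by rewrite addr_gt0.
have p0 y : 0 <= Pt s x y by rewrite heat_kernel_ge0// ltW.
have q0 y z : 0 <= Pt t y z by rewrite heat_kernel_ge0// ltW.
have s0' y z : 0 <= surprisal t y z by exact: surprisal_ge0.
have stoch : average (Pt s x) (fun=> 1%E) = 1%E.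
  by rewrite heat_kernel_stochastic// ltW.
pose d y : R := (dist G x y)%:R.
have -> : a + 4 * b * M = a + 2 * b * M + 2 * b * M by ring.
apply: (@le_trans _ _ (average (Pt (s + t) x) (fun z =>
    average (Pt s x) (fun y' => (surprisal t y' z)%:E)))).
  apply: le_average => [z|z _]; last exact: surprisal_jensen.
  by rewrite heat_kernel_ge0// ltW.
rewrite (average_mixture (p := Pt s x) (K := Pt t)) => //; last 2 first.
- by move=> z; apply: average_ge0 => // y; rewrite lee_fin.
- by move=> z; rewrite -heat_kernelD// ltW.
have b2 : 0 <= 2 * b by rewrite mulr_ge0.
have d2 y : (0 <= (d y ^+ 2)%:E)%E by rewrite lee_fin sqr_ge0.
have M0 : 0 <= M.
  by rewrite -lee_fin; apply: le_trans MH; rewrite second_moment_ge0// ltW.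
have step (c : R) : 0 <= c ->
    (average (Pt s x) (fun y => c%:E + (2 * b)%:E * (d y ^+ 2)%:E)
      <= (c + 2 * b * M)%:E)%E.
  move=> c0; rewrite averageD//; last first.
    by move=> y; rewrite mule_ge0// lee_fin.
  rewrite average_cst// averageZl// EFinD leeD2l//.
  by rewrite (EFinM (2 * b) M) lee_wpmul2l ?lee_fin.
apply: le_trans (step (a + 2 * b * M) _); last by rewrite addr_ge0// mulr_ge0.
apply: le_average => // y _.
rewrite average_exchange//.
have -> : ((a + 2 * b * M)%:E + (2 * b)%:E * (d y ^+ 2)%:E =
    ((a + 2 * b * d y ^+ 2) + 2 * b * M)%:E)%E.
  by rewrite -EFinM -EFinD; congr (_%:E); ring.
apply: le_trans (step _ _); last by rewrite addr_ge0// mulr_ge0// sqr_ge0.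
apply: le_average => // y' _; apply: le_trans (crossH y y') _.
rewrite -EFinM -EFinD lee_fin -addrA lerD2l -mulrDr [2 * b]mulrC -mulrA ler_wpM2l//.
have : (dist G y y')%:R <= d y + d y'.
  rewrite /d -natrD ler_nat (dist_sym (R := R) lf deg_gt0 conn x y).
  exact: dist_triangle lf deg_gt0 conn _ _ _.
have : 0 <= (dist G y y')%:R :> R by [].
have := sqr_ge0 (d y - d y'); rewrite !expr2; nra.
Qed.

Variable A : R.
Hypothesis A_ge0 : 0 <= A.
Hypothesis lh : LH G A.

(** A vertex y next to x with P_1(x,y) <= 1/deg x exists by pigeonhole, whereas
    P_1(y,y) >= 1/e. So the point y contributes about ln (deg x)/e to the
    divergence of P_1(y,.) from P_1(x,.), while the negative contributions add up
    to at least -1. *)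
Lemma ln_deg_le x : ln (m x) <= 1 + expR 1 * (2 * A + 1).
Proof.
have [y xy Pxy] : exists2 y, adj G x y & Pt 1 x y <= (m x)^-1.
  apply: contrapT => no.
  have big z : adj G x z -> (m x)^-1 < Pt 1 x z.
    by move=> xz; rewrite ltNge; apply/negP => h; apply: no; exists z.
  have : ((\sum_(z <- fset_set (neighbours G x)) Pt 1 x z)%:E <= 1)%E.
    rewrite -(heat_kernel_stochastic lf deg_gt0 x ler01) -sumEFin.
    apply: esum_ge; exists (neighbours G x); first by split.
    by rewrite fsbig_finite//=; under [leRHS]eq_bigr do rewrite mule1.
  rewrite lee_fin leNgt => /negP; apply.
  rewrite [ltLHS](_ : 1 = \sum_(z <- fset_set (neighbours G x)) (m x)^-1); last first.
    rewrite big_const_seq count_predT iter_addr_0 -[RHS]mulr_natr mulVf//.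
    by rewrite gt_eqF ?degR_gt0.
  rewrite big_seq [X in _ < X]big_seq; apply: ltr_sum => [|z]; last first.
    by rewrite in_neighbours// => xz; exact: big.
  apply/hasP; have := deg_gt0 x; rewrite /deg cardfs_gt0 => /fset0Pn[z xz].
  by exists z.
have p0 : 0 < Pt 1 y y by exact: heat_kernel_gt0.
have q0 z w : 0 < Pt 1 z w by exact: heat_kernel_gt0.
have pe : expR (- 1) <= Pt 1 y y.
  have := heat_kernel_ge (R := R) lf deg_gt0 y y 0 ler01.
  by rewrite /poisson /= eqxx expr0 fact0 divr1 !mulr1.
have : (relative_entropy (Pt 1 y) (Pt 1 x) <= (2 * A)%:E)%E.
  apply: le_trans (lh _ _ ltr01) _.
  have d1 : (dist G y x)%:R <= 1 :> R.
    by rewrite lern1 (dist_adj (R := R) lf deg_gt0)// adj_sym.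
  have d0 : 0 <= (dist G y x)%:R :> R by [].
  rewrite sqrtr1 !divr1 lee_fin [2 * A]mulrC ler_wpM2l//.
  by have := mulr_ile1 d0 d0 d1 d1; rewrite expr2; lra.
rewrite relative_entropy_heat_kernel// /signed_sum.
pose g z := (Pt 1 y z * ln (Pt 1 y z / Pt 1 x z))%:E; rewrite -/g.
set Sp := esum _ _; set Sn := esum _ _ => SK.
have Sn1 : (Sn <= 1)%E.
  rewrite -(heat_kernel_stochastic lf deg_gt0 x ler01).
  apply: le_esum => z _; rewrite mule1 funenegE /g -EFinN.
  rewrite -[X in maxe _ X]/(0%:E) -EFin_max lee_fin ge_max (ltW (q0 x z)) andbT.
  have := @le_ln1Dx R (Pt 1 x z / Pt 1 y z - 1).
  rewrite addrCA subrr addr0 !ln_div ?posrE// => h.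
  have {}h : ln (Pt 1 x z) - ln (Pt 1 y z) <= Pt 1 x z / Pt 1 y z - 1.
    by apply: h; rewrite ltrBrDl subrr divr_gt0.
  rewrite -mulrN opprB.
  apply: le_trans (ler_wpM2l (ltW (q0 y z)) h) _.
  have -> : Pt 1 y z * (Pt 1 x z / Pt 1 y z - 1) = Pt 1 x z - Pt 1 y z.
    by field; rewrite gt_eqF.
  by rewrite lerBlDr lerDl ltW.
have Sp_ge : ((Pt 1 y y * ln (Pt 1 y y / Pt 1 x y))%:E <= Sp)%E.
  apply: (@le_trans _ _ (g^\+%E y)); first by rewrite funeposE le_max lexx.
  rewrite /Sp (esumID [set y])// setTI esum_set1// leeDl// esum_ge0//.
have : ((Pt 1 y y * ln (Pt 1 y y / Pt 1 x y))%:E <= (2 * A + 1)%:E)%E.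
  apply: le_trans Sp_ge _; rewrite EFinD; apply: (@le_trans _ _ ((2 * A)%:E + Sn)%E).
    rewrite -leeBlDr// ge0_fin_numE; last by apply: esum_ge0 => z _.
    by apply: le_lt_trans Sn1 _; rewrite ltry.
  by rewrite leeD2l.
rewrite lee_fin => h.
have [|l1] := lerP (ln (m x)) 1.
  move=> /le_trans; apply; rewrite lerDl mulr_ge0 ?expR_ge0//.
  by rewrite addr_ge0// mulr_ge0.
have mx : 0 < m x by exact: degR_gt0.
have h2 : ln (m x) - 1 <= ln (Pt 1 y y / Pt 1 x y).
  have lp : -1 <= ln (Pt 1 y y) by rewrite -[-1]expRK ler_ln ?posrE ?expR_gt0.
  have lq : ln (Pt 1 x y) <= - ln (m x).
    by rewrite -lnV ?posrE// ler_ln ?posrE ?invr_gt0.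
  by rewrite ln_div ?posrE//; lra.
have l1' : 0 <= ln (m x) - 1 by rewrite subr_ge0 ltW.
have := ler_pM (expR_ge0 _) l1' pe h2 => /le_trans/(_ h).
rewrite expRN ler_pdivrMl ?expR_gt0//; lra.
Qed.

(** A crude bound; it turns the factorial in the Poisson weights into a
    multiple of the squared distance. *)
Lemma expR_sqr_fact k : k`!%:R <= expR (k%:R ^+ 2) :> R.
Proof.
elim: k => [|k IH]; first by rewrite fact0 expr2 mulr0 expR0.
rewrite factS natrM; have h1 : k.+1%:R <= expR k%:R :> R.
  by rewrite -natr1 addrC expR_ge1Dx.
apply: le_trans (ler_pM _ _ h1 IH) _ => //.
rewrite -expRD ler_expR -natr1; have : 0 <= k%:R :> R by [].
by rewrite !expr2; nra.
Qed.

(** Following a geodesic bounds the heat kernel from below. *)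
Lemma surprisal_le (L t : R) x z : (forall w, ln (m w) <= L) -> 1 <= t ->
  surprisal t x z <= t + L + (1 + L) * (dist G x z)%:R ^+ 2.
Proof.
move=> mL t1; have t0 : 0 < t by apply: lt_le_trans t1.
have m0 w : 0 < m w by exact: degR_gt0.
have L0 : 0 <= L by apply: le_trans (mL x); rewrite ln_ge0 ?degR_ge1.
set k := dist G x z.
have mD w : m w <= expR L by rewrite -ler_ln ?posrE ?expR_gt0// expRK.
have pk : 0 < Pn k x z by exact: walk_kernel_pow_dist_gt0.
have := walk_kernel_pow_ge lf deg_gt0 mD pk.
rewrite -expRN -expRM_natr => pge.
have fge : expR (- t) * expR (- (k%:R ^+ 2)) <= poisson t k.
  rewrite /poisson ler_wpM2l ?expR_ge0// expRN.
  apply: (@le_trans _ _ (k`!%:R^-1)).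
    by rewrite lef_pV2 ?posrE ?expR_gt0 ?ltr0n ?fact_gt0// expR_sqr_fact.
  by rewrite ler_peMl ?invr_ge0// exprn_ege1.
have := le_trans (ler_pM _ _ fge pge) (heat_kernel_ge lf deg_gt0 x z k (ltW t0)).
rewrite -!expRD => /(_ (expR_ge0 _) (expR_ge0 _)) Pge.
have P0 : 0 < Pt t x z by exact: heat_kernel_gt0.
have : - t + - k%:R ^+ 2 + - L * k%:R <= ln (Pt t x z).
  by rewrite -[leLHS]expRK ler_ln ?posrE ?expR_gt0.
rewrite /surprisal ln_div ?posrE//.
have kk : k%:R <= k%:R ^+ 2 :> R by rewrite -natrX ler_nat -mulnn; case: (k) => // n; exact: leq_pmulr.
have := ler_wpM2l L0 kk; have := mL z; lra.
Qed.

(** The starting point of the recursion: the surprisal is at most quadratic in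
    the distance, which has exponential moments. *)
Lemma entropy_short_time (L t : R) x : (forall w, ln (m w) <= L) ->
  1 <= t -> t <= 2 ->
  (entropy t x <= (2 + L + (1 + L) * (4 * expR 32))%:E)%E.
Proof.
move=> mL t1 t2; have t0 : 0 < t by apply: lt_le_trans t1.
have t0' := ltW t0.
have L0 : 0 <= L by apply: le_trans (mL x); rewrite ln_ge0 ?degR_ge1.
have p0 z : 0 <= Pt t x z by exact: heat_kernel_ge0.
have e0 z : 0 <= expR 2 ^+ dist G x z by rewrite exprn_ge0 ?expR_ge0.
have c0 : 0 <= (1 + L) * 4 by rewrite mulr_ge0// addr_ge0.
apply: (@le_trans _ _ (average (Pt t x) (fun z =>
    (2 + L)%:E + ((1 + L) * 4)%:E * (expR 2 ^+ dist G x z)%:E))%E).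
  apply: le_average => // z _; rewrite -EFinM -EFinD lee_fin.
  apply: le_trans (surprisal_le x z mL t1) _.
  rewrite lerD ?lerD2r// -mulrA ler_wpM2l ?addr_ge0//.
  apply: le_trans (sqr_le_expR _) _ => //; rewrite ler_pM2l//.
  by rewrite -expRM_natr ler_expR ler_peMl// ler1n.
rewrite averageD => [||z|z]//; last 2 first.
- by rewrite lee_fin addr_ge0.
- by rewrite mule_ge0// lee_fin.
rewrite average_cst ?addr_ge0//; last exact: heat_kernel_stochastic.
rewrite averageZl// (EFinD (2 + L)) leeD2l// mulrA (EFinM (_ * 4)) lee_wpmul2l ?lee_fin//.
apply: le_trans (average_expR2_dist lf deg_gt0 x t0') _.
by rewrite lee_fin ler_expR; lra.
Qed.

(** The extra time s comes first: after it, two copies of the walk are at squared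
    distance O(s (b + 1)), and the log-Harnack inequality at time t divides this
    by t. The term in d / sqrt t is absorbed by 2 d / sqrt t <= d^2/t + 1. *)
Lemma entropy_increment (s t a b : R) : 1 <= s -> 1 <= t ->
  (forall x, (entropy t x <= a%:E)%E) -> (forall x, (entropy s x <= b%:E)%E) ->
  forall x, (entropy (t + s) x <= (a + 512 * A * (s / t * (b + 1) + 1))%:E)%E.
Proof.
move=> s1 t1 Ha Hb x; have s0 : 0 < s by apply: lt_le_trans s1.
have t0 : 0 < t by apply: lt_le_trans t1.
have ent0 u y : 0 < u -> (0 <= entropy u y)%E.
  move=> u0; apply: average_ge0 => z; first by rewrite heat_kernel_ge0// ltW.
  by rewrite lee_fin (surprisal_ge0 lf).
have a0 : 0 <= a by rewrite -lee_fin (le_trans (ent0 t x t0)).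
have b0 : 0 <= b by rewrite -lee_fin (le_trans (ent0 s x s0)).
have tV : 0 <= t^-1 by rewrite invr_ge0 ltW.
have cross y y' : (cross_entropy t y y' <=
    (a + A + 2 * A / t * (dist G y y')%:R ^+ 2)%:E)%E.
  apply: le_trans (cross_entropy_le t0 (Ha y) (lh y y' t0)) _.
  rewrite lee_fin -addrA lerD2l; set d : R := (dist G y y')%:R.
  have := sqr_ge0 (d / Num.sqrt t - 1).
  have -> : (d / Num.sqrt t - 1) ^+ 2 = d ^+ 2 / t - 2 * (d / Num.sqrt t) + 1.
    by rewrite sqrrB1 expr_div_n sqr_sqrtr ?ltW//; ring.
  have dt : 0 <= d ^+ 2 / t by rewrite mulr_ge0 ?sqr_ge0.
  have -> : A + 2 * A / t * d ^+ 2 = A * (1 + 2 * (d ^+ 2 / t)) by ring.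
  by move=> h; rewrite ler_wpM2l//; lra.
rewrite addrC; apply: le_trans (entropyD_le s0 t0 _ _ cross
  (second_moment_le lf deg_gt0 conn s0 (Hb x))) _.
- by rewrite addr_ge0.
- by rewrite !mulr_ge0.
rewrite lee_fin -!addrA lerD2l.
have t1' : t^-1 <= 1 by rewrite invf_le1.
have -> : 4 * (2 * A / t) * (64 * s * (b + 1) + 4) =
  512 * A * (s / t * (b + 1)) + 32 * (A * t^-1) by ring.
rewrite [512 * A * (_ + 1)]mulrDr mulr1.
by have := ler_wpM2l A_ge0 t1'; rewrite mulr1; move: A_ge0; lra.
Qed.

(** The entropy at time t = r^2 bounds the surprisal at time 2 t on the whole ball
    of radius r, that is, P_2t(x,y) from below by a multiple of m y; and the
    total mass of P_2t(x,.) is 1. *)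
Lemma Vol_le (r H : R) x : 0 < r -> (entropy (r ^+ 2) x <= H%:E)%E ->
  (Vol R G (graph_ball G x r) <= (expR (H + 2 * A))%:E)%E.
Proof.
move=> r0 eH; set t := r ^+ 2; have t0 : 0 < t by rewrite exprn_gt0.
have tt0 : 0 <= t + t by rewrite addr_ge0// ltW.
set K := H + 2 * A; have K0 : 0 <= expR K by exact: expR_ge0.
rewrite -[leRHS]mule1 -(heat_kernel_stochastic lf deg_gt0 x tt0) -averageZl//; last first.
  by move=> z; rewrite heat_kernel_ge0.
rewrite /Vol esum_mkcond; apply: le_esum => y _.
case: ifPn => [|_]; last by rewrite mule1 mule_ge0 ?lee_fin ?heat_kernel_ge0.
rewrite inE /graph_ball/= => dr.
have m0 : 0 < m y by exact: degR_gt0.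
have P0 : 0 < Pt (t + t) x y by apply: heat_kernel_gt0 => //; rewrite addr_gt0.
rewrite mule1 -EFinM lee_fin mulrC.
suff : surprisal (t + t) x y <= K.
  rewrite /surprisal -ler_expR expRN lnK ?posrE ?divr_gt0// invf_div.
  by rewrite ler_pdivrMr.
rewrite -lee_fin; apply: le_trans (surprisal_jensen x y t0 t0) _.
rewrite (_ : average _ _ = cross_entropy t x y); last first.
  by apply: congr1; apply/funext => z; rewrite (surprisal_sym lf).
apply: (cross_entropy_le t0 eH); apply: le_trans (lh x y t0) _.
rewrite lee_fin [leRHS]mulrC ler_wpM2l//.
rewrite /t sqrtr_sqr gtr0_norm// -expr_div_n; set d : R := (dist G x y)%:R in dr *.
have d1 : d / r <= 1 by rewrite ler_pdivrMr// mul1r.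
have d0 : 0 <= d / r by rewrite divr_ge0// ltW.
rewrite expr2; nra.
Qed.

End LogHarnack.

(** * Iteration over dyadic times *)

Section DyadicRecursion.
Context {R : realType}.
(** Q n a stands for: the entropies at time tau 2^n are at most a. *)
Variables (Q : nat -> R -> Prop) (C H : R).
Hypothesis C_ge0 : 0 <= C.
Hypothesis H_ge1 : 1 <= H.
Hypothesis Q_le : forall n a b, a <= b -> Q n a -> Q n b.
Hypothesis Q0 : Q 0 H.
Hypothesis Q_step : forall n k a b, (k <= n)%N -> Q n a -> Q (n - k) b ->
  Q n.+1 (a + C * (b + 1) + C * 2 ^+ k).

(** The recursion without delay, k = 0. *)
Lemma dyadic_crude n : Q n (H * (2 + 3 * C) ^+ n).
Proof.
elim: n => [|n IH]; first by rewrite expr0 mulr1.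
have IH0 : Q (n - 0) (H * (2 + 3 * C) ^+ n) by rewrite subn0.
apply: Q_le (Q_step (leq0n n) IH IH0).
have B1 : 1 <= (2 + 3 * C) ^+ n.
  by rewrite exprn_ege1//; have := mulr_ge0 (ler0n R 3) C_ge0; lra.
have g1 := mulr_ege1 H_ge1 B1.
rewrite exprSr mulrA; move: g1; set g := H * _ => g1.
rewrite expr0; have := ler_wpM2l C_ge0 g1; lra.
Qed.

(** The increments over a block of k consecutive steps only involve bounds for the
    previous blocks, so that a block multiplies the bound by O(k) instead of
    exp (O(k)). The first block uses the recursion without delay. *)
Lemma dyadic_blocks k J n : (n <= J.+1 * k)%N ->
  Q n (H * (2 + 3 * C) ^+ k * (1 + 3 * C * k%:R) ^+ J).
Proof.
have B2 : 2 <= 2 + 3 * C by rewrite lerDl mulr_ge0.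
have B1 : 1 <= 2 + 3 * C by apply: le_trans B2; rewrite ler1n.
have Ck : 1 <= 1 + 3 * C * k%:R by rewrite lerDl !mulr_ge0.
elim: J n => [|J IH] n nJ.
  rewrite expr0 mulr1; apply: Q_le (dyadic_crude n).
  rewrite ler_wpM2l//; first by rewrite (le_trans ler01).
  by rewrite ler_weXn2l// -[k]mul1n.
rewrite exprSr mulrA; move: IH; set g := H * _ * _ => IH.
have g2 : 2 ^+ k <= g.
  have B0 : 0 <= 2 + 3 * C by apply: le_trans B1.
  have h1 : 2 ^+ k <= (2 + 3 * C) ^+ k by rewrite lerXn2r ?nnegrE.
  have h2 : (2 + 3 * C) ^+ k <= H * (2 + 3 * C) ^+ k by rewrite ler_peMl ?exprn_ge0.
  apply: (le_trans h1); apply: (le_trans h2).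
  by rewrite ler_peMr ?exprn_ege1// mulr_ge0 ?exprn_ge0// (le_trans ler01).
have g1 : 1 <= g by apply: le_trans g2; rewrite exprn_ege1// ler1n.
have g0 : 0 <= g by apply: le_trans g1.
have [/IH|Jn] := leqP n (J.+1 * k); first by apply: Q_le; rewrite ler_peMr.
have block i : (i <= k)%N -> Q (J.+1 * k + i) (g + i%:R * (3 * C * g)).
  elim: i => [|i IHi] ik; first by rewrite mul0r addr0; apply: IH; rewrite addn0.
  rewrite addnS.
  have kn : (k <= J.+1 * k + i)%N by rewrite mulSn -addnA leq_addr.
  apply: Q_le (Q_step kn (IHi (ltnW ik)) (IH _ _)); last first.
    by rewrite leq_subLR addnC leq_add2r ltnW.
  have : C * (g + 1 + 2 ^+ k) <= C * (3 * g) by rewrite ler_wpM2l//; lra.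
  rewrite -(natr1 i); lra.
have nE : n = (J.+1 * k + (n - J.+1 * k))%N by rewrite subnKC// ltnW.
rewrite {1}nE; apply: Q_le (block _ _); last by rewrite leq_subLR addnC -mulSn.
have nk : (n - J.+1 * k)%:R <= k%:R :> R.
  by rewrite ler_nat leq_subLR addnC -mulSn.
have : 3 * C * g * (n - J.+1 * k)%:R <= 3 * C * g * k%:R.
  by rewrite ler_wpM2l// mulr_ge0// mulr_ge0.
lra.
Qed.

End DyadicRecursion.

Section Growth.
Context {R : realType}.

Definition log_scale (t : R) : R := Num.sqrt (ln t * ln (ln t)).

Lemma log_scale_facts t : expR (expR 1) <= t ->
  [/\ 1 <= t, 1 <= ln (ln t), ln (ln t) <= ln t & 1 <= log_scale t].
Proof.
move=> tee; have t0 : 0 < t by apply: lt_le_trans tee; exact: expR_gt0.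
have e2 : 2 <= expR 1 :> R by have := @expR_ge1Dx R 1; lra.
have Le : expR 1 <= ln t by rewrite -[leLHS]expRK ler_ln ?posrE ?expR_gt0.
have L0 : 0 < ln t by apply: lt_le_trans Le; exact: expR_gt0.
have l1 : 1 <= ln (ln t) by rewrite -[leLHS]expRK ler_ln ?posrE ?expR_gt0.
split=> //.
- by apply: le_trans tee; rewrite -expR0 ler_expR expR_ge0.
- by rewrite ltW// ln_sublinear.
- rewrite -sqrtr1 /log_scale ler_sqrt; last by rewrite mulr_ge0// ltW// (lt_le_trans ltr01).
  by apply: mulr_ege1 => //; lra.
Qed.

Lemma ln2_bounds : 2^-1 <= ln (2 : R) /\ ln (2 : R) <= 1.
Proof.
split; first by rewrite -[leLHS]expRK ler_ln ?posrE ?expR_gt0 ?expR_half_le2.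
by have := @le_ln1Dx R 1; rewrite (_ : 1 + 1 = 2)//; apply; lra.
Qed.

Lemma dyadic_decomposition (t : R) : 1 <= t ->
  exists N (tau : R), [/\ t = tau * 2 ^+ N, 1 <= tau & tau <= 2].
Proof.
move=> t1; have t0 : 0 <= t by apply: le_trans t1.
have /andP[qt tq] := Num.Theory.truncn_itv t0; set q := Num.truncn t in qt tq.
have q0 : (0 < q)%N by rewrite truncn_gt0.
have /andP[Nq qN] := trunc_log_bounds (isT : 1 < 2)%N q0.
set N := trunc_log 2 q in Nq qN.
exists N, (t / 2 ^+ N).
have p0 : 0 < 2 ^+ N :> R by rewrite exprn_gt0.
split; first by rewrite divfK// gt_eqF.
- by rewrite ler_pdivlMr// mul1r; apply: le_trans qt; rewrite -natrX ler_nat.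
- rewrite ler_pdivrMr// -exprS; apply: le_trans (ltW tq) _.
  by rewrite -natrX ler_nat.
Qed.

(** With N of order L = ln t, the two powers have logarithms of order k and
    (L/k) ln k; they balance for k of order sqrt (L ln L). *)
Lemma block_bound_le (C H : R) : 0 <= C -> 1 <= H ->
  exists2 c : R, 0 <= c & forall (t tau : R) N, expR (expR 1) <= t ->
    t = tau * 2 ^+ N -> 1 <= tau -> exists k J : nat,
    (N <= J.+1 * k)%N /\
    H * (2 + 3 * C) ^+ k * (1 + 3 * C * k%:R) ^+ J <= expR (c * log_scale t).
Proof.
move=> C0 H1; have [l2 l2'] := ln2_bounds.
have C3 : 0 <= 3 * C by rewrite mulr_ge0.
have B1 : 1 <= 2 + 3 * C by lra.
have H0 : 0 < H by apply: lt_le_trans H1.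
have B0 : 0 < 2 + 3 * C by apply: lt_le_trans B1.
have D0 : 0 < 1 + 3 * C by lra.
pose c3 := ln (1 + 3 * C) + 2.
have lH : 0 <= ln H by exact: ln_ge0.
have lB : 0 <= ln (2 + 3 * C) by exact: ln_ge0.
have lD : 0 <= ln (1 + 3 * C) by apply: ln_ge0; lra.
exists (ln H + 2 * ln (2 + 3 * C) + 2 * c3).
  by rewrite /c3; lra.
move=> t tau N tee tE tau1; have [t1 l1 lL S1] := log_scale_facts tee.
set S := log_scale t in S1 *; set L := ln t in l1 lL *; set l := ln L in l1 lL *.
have L0 : 0 < L by lra.
have S2 : S ^+ 2 = L * l by rewrite /S /log_scale -/L -/l sqr_sqrtr// mulr_ge0 //; lra.
have NL : N%:R <= 2 * L.
  have : ln (2 ^+ N) <= L.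
    rewrite /L ler_ln ?posrE ?exprn_gt0 ?(lt_le_trans ltr01 t1)// [leRHS]tE.
    by rewrite ler_peMl// exprn_ge0.
  rewrite lnXn// -[ln 2 *+ N]mulr_natl; have := ler_wpM2l (ler0n R N) l2; lra.
have SL : S <= L.
  rewrite -(@ler_pXn2r _ 2)// ?nnegrE ?(ltW L0)//; last by lra.
  by rewrite S2 expr2 ler_wpM2l// ltW.
pose k := (Num.truncn S).+1.
have /andP[Sk kS] := Num.Theory.truncn_itv (le_trans ler01 S1).
have kS2 : k%:R <= 2 * S by rewrite /k -natr1; lra.
have k1 : 1 <= k%:R :> R by rewrite ler1n.
exists k, (N %/ k)%N; split.
  by rewrite ltnW// ltn_ceil.
set J := (N %/ k)%N.
have JL : J%:R * S <= 2 * L.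
  apply: le_trans NL; apply: (@le_trans _ _ (J%:R * k%:R)).
    by rewrite ler_wpM2l// ltW.
  by rewrite -natrM ler_nat leq_divM.
have lk : ln (1 + 3 * C * k%:R) <= c3 * l.
  apply: (@le_trans _ _ (ln ((1 + 3 * C) * (2 * L)))).
    rewrite ler_ln ?posrE//; last 2 first.
    - by have := mulr_ge0 C3 (ler0n R k); lra.
    - by rewrite !mulr_gt0.
    have : 3 * C * k%:R <= 3 * C * (2 * L) by rewrite ler_wpM2l//; lra.
    lra.
  rewrite !lnM ?posrE ?mulr_gt0// -/l /c3.
  have := ler_wpM2l lD l1; lra.
have -> : H = expR (ln H) by rewrite lnK ?posrE.
have -> : (2 + 3 * C) ^+ k = expR (k%:R * ln (2 + 3 * C)).
  by rewrite expRM_natl lnK ?posrE.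
have Dk : 0 < 1 + 3 * C * k%:R by have := mulr_ge0 C3 (ler0n R k); lra.
have -> : (1 + 3 * C * k%:R) ^+ J = expR (J%:R * ln (1 + 3 * C * k%:R)).
  by rewrite expRM_natl lnK ?posrE.
rewrite -!expRD ler_expR expRK.
have h1 := ler_wpM2l lH S1.
have h2 := ler_wpM2r lB kS2.
have h3 := ler_wpM2l (ler0n R J) lk.
have c30 : 0 <= c3 by rewrite /c3; lra.
have h4 : J%:R * (c3 * l) <= 2 * c3 * S.
  rewrite -(ler_pM2r (lt_le_trans ltr01 S1)) -[leRHS]mulrA -expr2 S2.
  have := ler_wpM2l (mulr_ge0 c30 (le_trans ler01 l1)) JL.
  by rewrite [leLHS](_ : _ = J%:R * (c3 * l) * S) 1?[leRHS](_ : _ = 2 * c3 * (L * l)); [|ring|ring].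
lra.
Qed.

End Growth.

(** * Growth of entropy, displacement and volume *)

Section EntropyGrowth.
Context {R : realType} {V : choiceType} {G : simple_graph V}.
Hypothesis lf : locally_finite G.
Hypothesis deg_gt0 : forall x, (0 < deg G x)%N.
Hypothesis conn : connected_graph G.
Variable A : R.
Hypothesis A_ge0 : 0 <= A.
Hypothesis lh : LH G A.

Local Notation entropy := (@entropy R V G).

(** Each of the K steps adds at most a K-th of b + 1, plus 1, up to a factor. So
    the entropy b at the much earlier time u / K counts only once, and the price
    is the term in K. *)
Lemma entropy_double (u a b : R) (K : nat) : (0 < K)%N -> K%:R <= u ->
  (forall x, (entropy u x <= a%:E)%E) ->
  (forall x, (entropy (u / K%:R) x <= b%:E)%E) ->
  forall x, (entropy (u * 2) x <=
    (a + 512 * A * (b + 1) + 512 * A * K%:R)%:E)%E.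
Proof.
move=> K0 Ku Ha Hb; have K0' : 0 < K%:R :> R by rewrite ltr0n.
have u1 : 1 <= u by apply: le_trans Ku; rewrite ler1n.
set s := u / K%:R in Hb; have s1 : 1 <= s by rewrite ler_pdivlMr// mul1r.
move=> x; have b0 : 0 <= b.
  rewrite -lee_fin; apply: le_trans _ (Hb x); apply: average_ge0 => z.
    by rewrite heat_kernel_ge0//; lra.
  by rewrite lee_fin (surprisal_ge0 lf)//; lra.
have steps i y : (entropy (u + i%:R * s) y <=
    (a + i%:R * (512 * A * ((b + 1) / K%:R + 1)))%:E)%E.
  elim: i y => [|i IH] y; first by rewrite !mul0r !addr0.
  have v1 : u <= u + i%:R * s by rewrite lerDl mulr_ge0//; lra.
  have -> : u + i.+1%:R * s = (u + i%:R * s) + s by rewrite -(natr1 i); ring.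
  set D := 512 * A * _ in IH *.
  have -> : a + i.+1%:R * D = (a + i%:R * D) + D by rewrite -(natr1 i); ring.
  apply: le_trans (entropy_increment lf deg_gt0 conn A_ge0 lh s1
    (le_trans u1 v1) IH Hb y) _.
  have C0 : 0 <= 512 * A by rewrite mulr_ge0 ?ler0n.
  rewrite lee_fin lerD2l /D ler_wpM2l// lerD2r mulrC ler_wpM2l//.
    by rewrite addr_ge0.
  rewrite ler_pdivrMr; last by lra.
  by rewrite mulrC ler_wpM2r// invr_ge0 ltW.
have := steps K x.
have -> : u + K%:R * s = u * 2 by rewrite /s; field; rewrite gt_eqF.
have -> : a + K%:R * (512 * A * ((b + 1) / K%:R + 1)) =
   a + 512 * A * (b + 1) + 512 * A * K%:R by field; rewrite gt_eqF.
by [].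
Qed.

End EntropyGrowth.

Lemma deg_gt0_of_connected (V : choiceType) (G : simple_graph V) :
  has_edge G -> connected_graph G -> locally_finite G ->
  forall x, (0 < deg G x)%N.
Proof.
move=> [u [v uv]] conn lf x; rewrite /deg cardfs_gt0; apply/fset0Pn.
suff [y xy] : exists y, adj G x y by exists y; rewrite in_neighbours.
have [n /asboolP[[|y s] [/= ps ls _]]] := conn x u.
  by exists v; rewrite ls.
by exists y; case/andP: ps.
Qed.

Theorem entropy_growth (R : realType) (A : R) : 0 <= A ->
  exists2 c : R, 0 <= c &
  forall (V : choiceType) (G : simple_graph V),
    connected_graph G -> locally_finite G -> (forall x, (0 < deg G x)%N) ->
    LH G A ->
  forall (x : V) (t : R), expR (expR 1) <= t ->
    (@entropy R V G t x <= (expR (c * log_scale t))%:E)%E.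
Proof.
move=> A0; pose L := 1 + expR 1 * (2 * A + 1).
have L0 : 0 <= L by rewrite addr_ge0// mulr_ge0 ?expR_ge0// addr_ge0// mulr_ge0.
pose H := 2 + L + (1 + L) * (4 * expR 32).
have H1 : 1 <= H.
  have : 0 <= (1 + L) * (4 * expR 32) by rewrite !mulr_ge0 ?expR_ge0// addr_ge0.
  by rewrite /H; lra.
have C0 : 0 <= 512 * A by rewrite mulr_ge0 ?ler0n.
have [c c0 cP] := block_bound_le C0 H1; exists c => //.
move=> V G conn lf dg lh x t tee; have [t1 _ _ _] := log_scale_facts tee.
have [N [tau [tE tau1 tau2]]] := dyadic_decomposition t1.
have [k [J [NJ bound]]] := cP t tau N tee tE tau1.
pose Q n a := forall y, (@entropy R V G (tau * 2 ^+ n) y <= a%:E)%E.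
have Q0 : Q 0%N H.
  have mL w : ln (deg G w)%:R <= L by exact: ln_deg_le.
  by move=> y; rewrite expr0 mulr1; exact: entropy_short_time.
have Q_le n a b : a <= b -> Q n a -> Q n b.
  by move=> ab Qa y; apply: le_trans (Qa y) _; rewrite lee_fin.
have Q_step n i a b : (i <= n)%N -> Q n a -> Q (n - i)%N b ->
    Q n.+1 (a + 512 * A * (b + 1) + 512 * A * 2 ^+ i).
  move=> ni Qa Qb y; have p0 j : 0 < 2 ^+ j :> R by rewrite exprn_gt0.
  have K0 : (0 < 2 ^ i)%N by rewrite expn_gt0.
  have Ku : (2 ^ i)%:R <= tau * 2 ^+ n.
    rewrite natrX; apply: le_trans (_ : _ <= 2 ^+ n) _.
      by rewrite ler_weXn2l// ler1n.
    by rewrite ler_peMl// ltW.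
  have Qb' z : (@entropy R V G (tau * 2 ^+ n / (2 ^ i)%:R) z <= b%:E)%E.
    have -> : tau * 2 ^+ n / (2 ^ i)%:R = tau * 2 ^+ (n - i) :> R.
      by rewrite natrX -[in LHS](subnK ni) exprD mulrA mulfK// gt_eqF.
    exact: Qb.
  have := entropy_double lf dg conn A0 lh K0 Ku Qa Qb' y.
  by rewrite -mulrA -exprSr natrX.
have := dyadic_blocks C0 H1 Q_le Q0 Q_step NJ; rewrite /Q -tE => /(_ x).
by move=> /le_trans; apply; rewrite lee_fin.
Qed.


Theorem theorem2p4 (R : realType) (A : R) :
  exists C : R,
  forall (V : choiceType) (G : simple_graph V),
    has_edge G -> connected_graph G -> locally_finite G -> LH G A ->
    forall (x : V) (r t : R), expR (expR 1) <= r -> expR (expR 1) <= t ->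
    [/\ (walk_expectation G t x (fun y => (dist G x y)%:R ^+ 2)%R <=
           (t * expR (C * Num.sqrt (ln t * ln (ln t))))%:E)%E,
        (heat_entropy G t x <=
           (expR (C * Num.sqrt (ln t * ln (ln t))))%:E)%E
      & (lne (Vol R G (graph_ball G x r)) <=
           (expR (C * Num.sqrt (ln r * ln (ln r))))%:E)%E].
Proof.
pose A' := Num.max A 0; have A0 : 0 <= A' by rewrite le_max lexx orbT.
have [c c0 cP] := entropy_growth A0.
(* The factor 2 in 2 c comes from log_scale (r^2) <= 2 log_scale r, and 132 from
   64 t (e + 1) + 4 <= 132 t e for t, e >= 1. *)
exists (2 * c + 2 * A' + 132) => V G edge conn lf lh x r t ree tee.
have dg := deg_gt0_of_connected edge conn lf.
have lh' : LH G A'.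
  move=> y y' u u0; apply: le_trans (lh y y' u u0) _.
  rewrite lee_fin ler_wpM2r ?le_max ?lexx//.
  by rewrite addr_ge0// divr_ge0 ?sqrtr_ge0 ?sqr_ge0// ltW.
have growth y u : expR (expR 1) <= u ->
    (entropy u y <= (expR (c * log_scale u))%:E)%E := cP V G conn lf dg lh' y u.
rewrite -!/(log_scale _).
have [t1 _ _ St] := log_scale_facts tee; have [r1 r2 r3 Sr] := log_scale_facts ree.
have t0 : 0 < t by lra.
have r0 : 0 < r by lra.
have grow d S : 1 <= S -> 0 <= d -> 1 + d <= expR (d * S) :> R.
  move=> S1 d0; apply: le_trans (expR_ge1Dx _) _.
  by rewrite ler_expR ler_peMr.
have exp1 S : 1 <= S -> 1 <= expR (c * S) :> R.
  by move=> S1; rewrite -expR0 ler_expR mulr_ge0//; lra.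
split.
- have -> : walk_expectation G t x (fun y => (dist G x y)%:R ^+ 2) =
      @second_moment R V G t x.
    by apply: eq_esum => y _; rewrite EFinM.
  apply: le_trans (second_moment_le lf dg conn t0 (growth x t tee)) _.
  rewrite lee_fin; have e1 := exp1 _ St.
  apply: (@le_trans _ _ (t * (expR (c * log_scale t) * (1 + 132)))).
    set e := expR _ in e1 *.
    have te : 1 <= t * e by apply: mulr_ege1.
    have te' : t <= t * e by rewrite ler_peMr// ltW.
    lra.
  rewrite ler_pM2l//.
  apply: (@le_trans _ _ (expR (c * log_scale t) * expR (132 * log_scale t))).
    by rewrite ler_wpM2l ?expR_ge0// grow ?ler0n.
  rewrite -expRD ler_expR -mulrDl ler_wpM2r//; lra.
- rewrite (heat_entropyE lf)//; apply: le_trans (growth x t tee) _.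
  by rewrite lee_fin ler_expR ler_wpM2r//; lra.
have r2ee : expR (expR 1) <= r ^+ 2.
  by apply: le_trans ree _; rewrite expr2 ler_peMr// ltW.
have := Vol_le lf dg conn A0 lh' r0 (growth x _ r2ee); set K := _ + 2 * A'.
move=> VolK; apply: (@le_trans _ _ K%:E).
  rewrite -[K in leRHS]expRK -lne_EFin ?expR_gt0// lee_lne//.
    by rewrite in_itv/= leey andbT; apply: esum_ge0 => z _; rewrite lee_fin.
  by rewrite in_itv/= leey andbT lee_fin expR_ge0.
rewrite lee_fin /K; set S := log_scale r in Sr *.
have [_ l2] := @ln2_bounds R.
have lr0 : 0 < ln r by lra.
have Sr2 : log_scale (r ^+ 2) <= 2 * S.
  have S2 : S ^+ 2 = ln r * ln (ln r) by rewrite sqr_sqrtr// mulr_ge0//; lra.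
  rewrite -(@ler_pXn2r _ 2)// ?nnegrE ?sqrtr_ge0//; last by lra.
  rewrite exprMn S2 /log_scale lnXn// -[ln r *+ 2]mulr_natl lnM ?posrE//.
  have h : 2 * ln r * (ln 2 + ln (ln r)) <= 2 * ln r * (2 * ln (ln r)).
    by rewrite ler_wpM2l//; lra.
  rewrite sqr_sqrtr; last by rewrite mulr_ge0//; have := ln2_bounds (R := R); lra.
  by apply: le_trans h _; rewrite le_eqVlt; apply/orP; left; apply/eqP; ring.
have e1 : 1 <= expR (2 * c * S) by rewrite -expR0 ler_expR !mulr_ge0//; lra.
apply: (@le_trans _ _ (expR (2 * c * S) * (1 + 2 * A'))).
  have : expR (c * log_scale (r ^+ 2)) <= expR (2 * c * S).
    by rewrite ler_expR -mulrA mulrCA ler_wpM2l.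
  by have := ler_wpM2l A0 e1; lra.
apply: (@le_trans _ _ (expR (2 * c * S) * expR (2 * A' * S))).
  by rewrite ler_wpM2l ?expR_ge0// grow// mulr_ge0.
rewrite -expRD ler_expR -mulrDl ler_wpM2r//; lra.
Qed.
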